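(* Let $f\in\mathbb{S}_d$ and define $X_f:=\overline{\{\mathcal{T}_vf\colon v\in\mathbb{R}^d\}}\subseteq\mathbb{S}_d$. Then \[d^*(f)=\sup\left\{\int_{\mathbb{S}_d}\int_{[0,1]^d}h(x)\,dx\,d\mu(h)\colon \mu\in\mathcal{M}_{\mathcal{T}}\text{ and }\mu(X_f)=1\right\},\] and this supremum is attained by some ergodic measure $\mu\in\mathcal{M}_{\mathcal{T}}$ with $\mu(X_f)=1$.
   Context: $\mathbb{S}_d$ denotes the set of all $f\in L^\infty(\mathbb{R}^d)$ with $0\le f\le1$ almost everywhere, with the weak-* topology inherited from $L^\infty(\mathbb{R}^d)\simeq L^1(\mathbb{R}^d)^*$ (compact metrisable); closures are taken in this topology. For $v\in\mathbb{R}^d$, $\mathcal{T}_v\colon\mathbb{S}_d\to\mathbb{S}_d$ is $(\mathcal{T}_vf)(x)=f(x+v)$. $\mathcal{M}_{\mathcal{T}}$ denotes the set of Borel probability measures $\mu$ on $\mathbb{S}_d$ which are invariant under every $\mathcal{T}_v$, $v\in\mathbb{R}^d$; such $\mu$ is ergodic if every Borel set $A$ with $\mathcal{T}_vA=A$ up to $\mu$-null sets for all $v$ has $\mu(A)\in\{0,1\}$. With $m$ Lebesgue measure and $Q(v,t)$ the closed axis-parallel cube of centre $v$ and side $t$, $d^*(f):=\limsup_{t\to\infty}\sup_{v\in\mathbb{R}^d}\frac{1}{m(Q(v,t))}\int_{Q(v,t)}f(x)\,dx$. *)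

(* Defs.v *)
From HB Require Import structures.
From mathcomp Require Import all_boot all_order all_algebra.
From mathcomp Require Import all_classical all_reals all_analysis.
Set Implicit Arguments. Unset Strict Implicit. Unset Printing Implicit Defensive.
Import Order.TTheory GRing.Theory Num.Theory.
Import numFieldNormedType.Exports.
Local Open Scope classical_set_scope.
Local Open Scope ring_scope.

Section Sd.
Variables (R : realType) (d : nat).

(** Points of R^d are d-tuples of reals, with the product (= Borel)
    sigma-algebra provided by MathComp-Analysis. *)
Definition tadd (x v : d.-tuple R) : d.-tuple R := [tuple tnth x i + tnth v i | i < d].

(** Iterated Lebesgue integral over R^d of a nonnegative function
    (by Tonelli, for Borel nonnegative F this is the integral against
    d-dimensional Lebesgue measure). *)
Fixpoint iint (n : nat) : (n.-tuple R -> \bar R) -> \bar R :=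
  match n return (n.-tuple R -> \bar R) -> \bar R with
  | 0 => fun F => F [tuple]
  | n'.+1 => fun F =>
      (\int[@lebesgue_measure R]_t iint (fun v : n'.-tuple R => F [tuple of t :: v]))%E
  end.

(** Elements of S_d: (Borel representatives of) classes of measurable
    f : R^d -> R with 0 <= f <= 1. *)
Record Sd := MkSd {
  sfun : d.-tuple R -> R ;
  sfun_meas : measurable_fun [set: d.-tuple R] sfun ;
  sfun_ge0 : forall x, 0 <= sfun x ;
  sfun_le1 : forall x, sfun x <= 1 }.

Lemma Sd0_ge0 (x : d.-tuple R) : 0 <= (cst 0 : d.-tuple R -> R) x. Proof. by []. Qed.
Lemma Sd0_le1 (x : d.-tuple R) : (cst 0 : d.-tuple R -> R) x <= 1. Proof. by rewrite /= ler01. Qed.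
Definition Sd0 : Sd := MkSd (@measurable_cst _ _ _ R setT 0) Sd0_ge0 Sd0_le1.

HB.instance Definition _ := gen_eqMixin Sd.
HB.instance Definition _ := gen_choiceMixin Sd.
HB.instance Definition _ := isPointed.Build Sd Sd0.

Lemma measurable_tadd (v : d.-tuple R) : measurable_fun [set: d.-tuple R] (tadd ^~ v).
Proof.
apply/measurable_fun_tnthP => i /=.
have -> : (@tnth d R ^~ i \o tadd^~ v) = ((@tnth d R ^~ i) \+ cst (tnth v i)).
  by apply: funext => x /=; rewrite tnth_mktuple.
apply: measurable_realfun.measurable_funD; first exact: measurable_tnth.
exact: measurable_cst.
Qed.

Definition Tshift (v : d.-tuple R) (f : Sd) : Sd :=
  @MkSd (fun x => sfun f (tadd x v))
    (measurableT_comp (sfun_meas f) (measurable_tadd v))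
    (fun x => sfun_ge0 f (tadd x v)) (fun x => sfun_le1 f (tadd x v)).

Definition integrable_Rd (g : d.-tuple R -> R) : Prop :=
  measurable_fun [set: d.-tuple R] g /\ (iint (fun x => `|g x|%:E) < +oo)%E.

Definition pairing (f : Sd) (g : d.-tuple R -> R) : R :=
  fine (iint (fun x => (sfun f x * Num.max (g x) 0)%:E))
  - fine (iint (fun x => (sfun f x * Num.max (- g x) 0)%:E)).

Definition wopen (A : set Sd) : Prop :=
  forall f, A f -> exists (n : nat) (g : 'I_n -> d.-tuple R -> R) (e : R),
    0 < e /\ (forall i, integrable_Rd (g i)) /\
    (forall h, (forall i, `|pairing h (g i) - pairing f (g i)| < e) -> A h).

Definition wclosure (A : set Sd) : set Sd :=
  [set f | forall U, wopen U -> U f -> U `&` A !=set0].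

Definition SdB := g_sigma_algebraType wopen.

Definition T_invariant (mu : probability SdB R) : Prop :=
  forall (v : d.-tuple R) (A : set SdB), measurable A ->
    mu (Tshift v @^-1` A) = mu A.

Definition T_ergodic (mu : probability SdB R) : Prop :=
  forall A : set SdB, measurable A ->
    (forall v : d.-tuple R,
        mu ((Tshift v @` A `\` A) `|` (A `\` Tshift v @` A)) = 0%E) ->
    mu A = 0%E \/ mu A = 1%E.

Definition unit_cube : set (d.-tuple R) :=
  [set x | forall i, 0 <= tnth x i <= 1].
Definition cube (v : d.-tuple R) (t : R) : set (d.-tuple R) :=
  [set x | forall i, tnth v i - t / 2 <= tnth x i <= tnth v i + t / 2].

Definition cube_mass (h : SdB) : \bar R :=
  iint (fun x => (\1_unit_cube x * sfun h x)%:E).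

Definition sup_avg (f : Sd) (t : R) : \bar R :=
  ereal_sup [set (iint (fun x => (\1_(cube v t) x * sfun f x)%:E)
                   * ((t ^+ d)^-1)%:E)%E | v in [set: d.-tuple R]].

Definition dstar (f : Sd) : \bar R :=
  ereal_inf [set ereal_sup [set sup_avg f t | t in [set t | T <= t]] | T in [set T : R | 0 < T]].

End Sd.

(* Main.v *)
(* For a function phi on S_d and a finite family s of translations let
   avg s phi h be the mean of phi (T_v h) over v in s.  On continuous functions,
   p phi := inf_s sup_u avg s phi (T_u f) is sublinear and p (phi o T_v - phi) <= 0,
   because translations commute.  Every invariant probability mu on X_f satisfies
   \int phi dmu = \int (avg s phi) dmu <= p phi.  If m h is the mass of h on the unit
   cube, tiling large cubes by unit cubes gives d*(f) = p m.

   Conversely, a Hahn-Banach argument inside faces (Zorn) yields a linear L <= p with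
   L m = p m that is extreme among the linear functionals dominated by p.  As S_d is
   weak-* compact and second countable, L is integration against a Borel probability
   mu; L <= p makes mu invariant and carried by X_f, and extremality makes it ergodic. *)

Require Import Defs.
From HB Require Import structures.
From mathcomp Require Import all_boot all_order all_algebra.
From mathcomp Require Import all_classical all_reals all_analysis.
From mathcomp Require Import measurable_realfun ring lra.
Import Order.TTheory GRing.Theory Num.Theory.
Import numFieldNormedType.Exports.
Local Open Scope classical_set_scope.
Local Open Scope ring_scope.
Set Implicit Arguments. Unset Strict Implicit. Unset Printing Implicit Defensive.

(** * Iterated integrals *)

(** [Sd] consists of functions, not of classes modulo null sets, so the weak-* topology on it does
    not separate functions that agree almost everywhere. Arguments for compact Hausdorff or metric
    spaces are therefore replaced by ones that see points only through continuous functions: a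
    countable base is given by positivity sets of continuous functions, and the measure is a Daniell
    outer measure whose covers are continuous functions.

    Extremality is imposed on functionals before any measure exists. This avoids a topology on the
    space of measures and an ergodic decomposition: splitting [mu] along an invariant set is already
    a splitting of [L].

    Means are taken over arbitrary finite families, not over cubes, because subadditivity of p then
    needs no boundary estimate: the mean over the sums of two families is a mean of means, in either
    order. The geometry of cubes enters only in the comparison with d*, where a cube of side t is
    enlarged by a constant and the relative error is of order 1/t. *)

Section IteratedIntegral.
Variable R : realType.
Local Notation leb := (@lebesgue_measure R).

Lemma ge0_integral_translation (a : R) (f : R -> \bar R) :
  measurable_fun setT f -> (forall x, 0 <= f x)%E ->
  (\int[leb]_x f (x + a)%R = \int[leb]_x f x)%E.
Proof.
move=> mf f0.
pose S : measurableTypeR R -> measurableTypeR R := fun x => (x + a)%R.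
have mS : measurable_fun setT S.
  by apply: measurable_funD.
transitivity (\int[pushforward leb S]_x f x)%E.
  by rewrite ge0_integral_pushforward.
apply: eq_measure_integral => A mA _.
apply/esym/lebesgue_measure_unique => // _ [[b c]] _ <-.
rewrite /pushforward /=.
rewrite [X in _ = leb X](_ : _ = `]b - a, c - a]%classic); last first.
  by apply/seteqP; split => x /=; rewrite !in_itv /= ltrBlDr lerBrDr.
rewrite !lebesgue_measure_itv/= !lte_fin ltrD2r.
by case: ifP => // _; rewrite -!EFinB; congr EFin; lra.
Qed.

Lemma normal_pdf_gt0 (x : R) : 0 < normal_pdf 0 1 x.
Proof.
rewrite normal_pdfE ?oner_neq0// mulr_gt0 ?expR_gt0// normal_peak_gt0//.
Qed.

(** The Radon-Nikodym derivative of the normal law has the same integral as [normal_pdf] over every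
    measurable set, so the two agree almost everywhere. *)
Lemma ge0_integral_normal_prob (f : R -> \bar R) :
  measurable_fun setT f -> (forall x, 0 <= f x)%E ->
  (\int[normal_prob 0 1]_x f x = \int[leb]_x (f x * (normal_pdf 0 1 x)%:E))%E.
Proof.
move=> mf f0.
have dom := @normal_prob_dominates R 0 1.
rewrite -(Radon_Nikodym_SigmaFinite.change_of_variables dom)//.
have mg := measurable_int _ (Radon_Nikodym_SigmaFinite.f_integrable dom).
apply: ae_eq_integral => //.
- by apply: emeasurable_funM => //.
- by apply: emeasurable_funM => //; apply/measurable_EFinP; exact: measurable_normal_pdf.
- apply: ae_eqe_mul2l; apply: integral_ae_eq => //=.
  + exact: Radon_Nikodym_SigmaFinite.f_integrable.
  + by apply/measurable_EFinP; exact: measurable_normal_pdf.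
  + by move=> E _ mE; rewrite -Radon_Nikodym_SigmaFinite.f_integral.
Qed.

(* Weighting by a positive probability density turns all integrals over [R^n]
   into integrals for a finite measure. *)
Definition gauss_weight n (x : n.-tuple R) : R := \prod_(i < n) normal_pdf 0 1 (tnth x i).

Lemma gauss_weight_gt0 n (x : n.-tuple R) : 0 < gauss_weight x.
Proof. by apply: prodr_gt0 => i _; exact: normal_pdf_gt0. Qed.

Lemma measurable_gauss_weight n : measurable_fun setT (@gauss_weight n).
Proof.
apply: measurable_prod => i _.
apply: (measurableT_comp (measurable_normal_pdf 0 1)).
exact: measurable_tnth.
Qed.

Lemma gauss_weight_cons n (t : R) (x : n.-tuple R) :
  gauss_weight [tuple of t :: x] = normal_pdf 0 1 t * gauss_weight x.
Proof.
rewrite /gauss_weight big_ord_recl; congr (_ * _).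
by apply: eq_bigr => i _; rewrite tnthS.
Qed.

Lemma iint_ge0 n (F : n.-tuple R -> \bar R) : (forall x, 0 <= F x)%E -> (0 <= iint F)%E.
Proof.
elim: n F => [|n IH] F F0 //=.
by apply: integral_ge0 => t _; exact: IH.
Qed.

Lemma iint0 n : iint (fun _ : n.-tuple R => 0%E) = 0%E :> \bar R.
Proof. by elim: n => //= n IH; rewrite integral0_eq. Qed.

Lemma eq_iint n (F G : n.-tuple R -> \bar R) : (forall x, F x = G x) -> iint F = iint G.
Proof. by move=> FG; congr iint; apply/funext. Qed.

Lemma measurable_box n (a b : 'I_n -> R) :
  measurable [set x : n.-tuple R | forall i, a i <= tnth x i <= b i].
Proof.
rewrite (_ : [set _ | _] =
    \bigcap_(i in [set: 'I_n]) ((@tnth n R ^~ i) @^-1` `[a i, b i])).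
  apply: fin_bigcap_measurable => // i _; rewrite -[_ @^-1` _]setTI.
  exact: measurable_tnth.
apply/seteqP; split => x h i; last by have := h i I; rewrite /= in_itv.
by move=> _; rewrite /= in_itv /=; exact: h.
Qed.

Lemma measurable_uncurry_cons n :
  measurable_fun setT (fun z : measurableTypeR R * n.-tuple R =>
    [tuple of (z.1 : R) :: z.2]).
Proof.
by apply: measurable_cons.
Qed.

(** The measure is specified only by its integrals, which is all that Tonelli's theorem needs to
    pass from dimension n to n+1: take the product with a normal law and transport it along the cons
    map. *)
Lemma gauss_prob_exists n : exists P : probability (n.-tuple R) R,
  forall F : n.-tuple R -> \bar R, measurable_fun setT F -> (forall x, 0 <= F x)%E ->
   (\int[P]_x F x = iint (fun x => F x * (gauss_weight x)%:E))%E.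
Proof.
elim: n => [|n [P HP]].
  exists (dirac [tuple]) => F mF F0.
  by rewrite integral_dirac// diracT mul1e/= /gauss_weight big_ord0 mule1.
pose N := (normal_prob 0 1 : probability (measurableTypeR R) R).
pose X : {mfun (measurableTypeR R * n.-tuple R)%type >-> n.+1.-tuple R} :=
  mfun_Sub (mem_set (@measurable_uncurry_cons n)).
exists (distribution (N \x P)%E X) => F mF F0.
have mFX := measurableT_comp mF (@measurable_uncurry_cons n).
have mFt (t : R) : measurable_fun setT (fun v : n.-tuple R => F [tuple of t :: v]).
  by apply: (measurableT_comp mF); exact: measurable_cons.
have FX0 z : (0 <= (F \o X) z)%E by exact: F0.
have mG : measurable_fun setT (fubini_F P (F \o X)).
  exact: measurable_fun_fubini_tonelli_F mFX FX0.
rewrite ge0_integral_distribution// fubini_tonelli1//.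
rewrite (ge0_integral_normal_prob mG); last by move=> x; exact: integral_ge0.
apply: eq_integral => t _ /=.
rewrite -(ge0_integralZr _ measurableT (mFt t))//; last by rewrite lee_fin ltW// normal_pdf_gt0.
rewrite HP.
- by apply: eq_iint => v; rewrite gauss_weight_cons EFinM muleA.
- by apply: emeasurable_funM; [exact: mFt|exact: measurable_cst].
- by move=> v; rewrite mule_ge0// lee_fin ltW// normal_pdf_gt0.
Qed.

Definition gauss_prob n : probability (n.-tuple R) R :=
  projT1 (cid (gauss_prob_exists n)).

Lemma measurable_gauss_weightV n :
  measurable_fun setT (fun x : n.-tuple R => (gauss_weight x)^-1).
Proof.
rewrite (_ : (fun _ => _) = (fun x => expR (- ln (gauss_weight x)))).
  apply: (measurableT_comp (@measurable_expR R)).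
  apply: (measurableT_comp (@oppr_measurable R setT)).
  exact: (measurableT_comp (@measurable_ln R) (@measurable_gauss_weight n)).
by apply/funext => x; rewrite expRN lnK// posrE gauss_weight_gt0.
Qed.

Lemma iintE n (F : n.-tuple R -> \bar R) :
  measurable_fun setT F -> (forall x, 0 <= F x)%E ->
  iint F = (\int[gauss_prob n]_x (F x * ((gauss_weight x)^-1)%:E))%E.
Proof.
move=> mF F0; rewrite /gauss_prob; case: cid => P /= ->.
- apply: eq_iint => x; rewrite -muleA -EFinM mulVf ?mule1//.
  by rewrite gt_eqF// gauss_weight_gt0.
- apply: emeasurable_funM => //; apply/measurable_EFinP.
  exact: measurable_gauss_weightV.
- by move=> x; rewrite mule_ge0// lee_fin invr_ge0 ltW// gauss_weight_gt0.
Qed.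

Lemma le_iint n (F G : n.-tuple R -> \bar R) :
  measurable_fun setT F -> measurable_fun setT G ->
  (forall x, 0 <= F x)%E -> (forall x, F x <= G x)%E -> (iint F <= iint G)%E.
Proof.
move=> mF mG F0 FG.
have G0 x : (0 <= G x)%E by exact: le_trans (FG x).
have mV : measurable_fun setT (fun x : n.-tuple R => ((gauss_weight x)^-1)%:E).
  by apply/measurable_EFinP; exact: measurable_gauss_weightV.
have w0 x : (0 <= ((@gauss_weight n x)^-1)%:E)%E.
  by rewrite lee_fin invr_ge0 ltW// gauss_weight_gt0.
rewrite !iintE//; apply: ge0_le_integral => //.
- by move=> x _; exact: mule_ge0.
- exact: emeasurable_funM.
- exact: emeasurable_funM.
- by move=> x _; exact: lee_wpmul2r.
Qed.

Lemma measurable_fun_cons n (t : R) (F : n.+1.-tuple R -> \bar R) :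
  measurable_fun setT F ->
  measurable_fun setT (fun v : n.-tuple R => F [tuple of t :: v]).
Proof. by move=> mF; apply: (measurableT_comp mF); exact: measurable_cons. Qed.

Lemma measurable_iint_cons n (F : n.+1.-tuple R -> \bar R) :
  measurable_fun setT F -> (forall x, 0 <= F x)%E ->
  measurable_fun setT (fun t : R => iint (fun v => F [tuple of t :: v])).
Proof.
move=> mF F0.
have mFX := measurableT_comp mF (@measurable_uncurry_cons n).
pose G := fun z : measurableTypeR R * n.-tuple R =>
  (F [tuple of (z.1 : R) :: z.2] * ((gauss_weight z.2)^-1)%:E)%E.
have mG : measurable_fun setT G.
  apply: emeasurable_funM => //; apply/measurable_EFinP.
  exact: (measurableT_comp (@measurable_gauss_weightV n)).
have G0 z : (0 <= G z)%E.
  by rewrite mule_ge0// lee_fin invr_ge0 ltW// gauss_weight_gt0.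
have := @measurable_fun_fubini_tonelli_F _ _ _ _ _ (gauss_prob n) G mG G0.
congr (measurable_fun _ _); apply/funext => t; rewrite /fubini_F iintE//.
exact: measurable_fun_cons.
Qed.

Lemma tadd_cons n (t a : R) (x v : n.-tuple R) :
  tadd [tuple of t :: x] [tuple of a :: v] = [tuple of t + a :: tadd x v].
Proof.
apply: eq_from_tnth => i; rewrite tnth_mktuple.
by case: (unliftP ord0 i) => [j ->|->] //; rewrite !tnthS tnth_mktuple.
Qed.

Lemma iint_tadd n (v : n.-tuple R) (F : n.-tuple R -> \bar R) :
  measurable_fun setT F -> (forall x, 0 <= F x)%E ->
  iint (fun x => F (tadd x v)) = iint F.
Proof.
elim: n v F => [|n IH] v F mF F0 /=; first by rewrite [tadd _ _]tuple0.
transitivity (\int[leb]_t iint (fun x => F [tuple of ((t : R) + thead v)%R :: x]))%E.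
  apply: eq_integral => t _.
  rewrite -(IH [tuple of behead v] (fun x => F [tuple of _ :: x]))//; last first.
    exact: measurable_fun_cons.
  by apply: eq_iint => x; rewrite [in LHS](tuple_eta v) tadd_cons.
apply: (@ge0_integral_translation (thead v) (fun t : R => iint (fun x => F [tuple of t :: x]))).
  exact: measurable_iint_cons.
by move=> t; exact: iint_ge0.
Qed.

End IteratedIntegral.

(** * The weak-* topology *)

Section WeakTopology.
Variables (R : realType) (d : nat).
Local Notation Sd := (Defs.Sd R d).
Local Notation wopen := (@Defs.wopen R d).

Lemma wopenT : wopen setT.
Proof.
by move=> f _; exists 0%N, (fun _ _ => 0), 1; split => //; split => // -[].
Qed.

Lemma wopenI : setI_closed wopen.
Proof.
move=> A B oA oB f [Af Bf].
have [n1 [g1 [e1 [e10 [ig1 h1]]]]] := oA f Af.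
have [n2 [g2 [e2 [e20 [ig2 h2]]]]] := oB f Bf.
exists (n1 + n2)%N, (fun i => match fintype.split i with inl a => g1 a | inr b => g2 b end).
exists (Num.min e1 e2); split; first by rewrite lt_min e10.
split; first by move=> i; case: fintype.split.
move=> h H; split; [apply: h1 => i|apply: h2 => i].
- have := H (lshift n2 i); rewrite -[lshift n2 i]/(unsplit (inl i)) unsplitK.
  by rewrite lt_min => /andP[].
- have := H (rshift n1 i); rewrite -[rshift n1 i]/(unsplit (inr i)) unsplitK.
  by rewrite lt_min => /andP[].
Qed.

Lemma wopen_bigU (I : Type) (F : I -> set Sd) :
  (forall i, wopen (F i)) -> wopen (\bigcup_i F i).
Proof.
move=> oF f [i _ Fif]; have [n [g [e [e0 [ig h]]]]] := oF i f Fif.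
by exists n, g, e; split => //; split => // h' /h; exists i.
Qed.

(** With this instance [open] unfolds to [wopen], so the general lemmas on compactness and
    continuity apply to the given weak-* topology. *)
HB.instance Definition _ := isOpenTopological.Build (Defs.Sd R d) wopenT wopenI wopen_bigU.

Local Notation P := (gauss_prob R d).
Local Notation w := (@gauss_weight R d).
Local Notation L1 k := (P.-integrable setT (EFin \o k)).

(* [wpair k f] is [pairing f g] for [k = g / gauss_weight], see [pairingE]. *)
Definition wpair (k : d.-tuple R -> R) (f : Sd) : R := \int[P]_x (Defs.sfun f x * k x).

Lemma Sd_mulr_integrable (f : Sd) k : L1 k -> L1 (fun x => Defs.sfun f x * k x).
Proof.
move=> ik; apply: (integrableMr measurableT (sfun_meas f) _ ik).
exists 1; split => // x x1 y _ /=; rewrite ger0_norm ?sfun_ge0//.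
by rewrite (le_trans (sfun_le1 _ _))// ltW.
Qed.

Lemma integrable_Rd_div g : integrable_Rd g -> L1 (fun x => g x / w x).
Proof.
move=> [mg ig].
have mk : measurable_fun setT (fun x => g x / w x).
  by apply: measurable_funM => //; exact: measurable_gauss_weightV.
apply/integrableP; split; first exact/measurable_EFinP.
move: ig; rewrite iintE//; last first.
  by apply/measurable_EFinP; exact: measurableT_comp.
congr (_ < _)%E; apply: eq_integral => x _.
by rewrite -EFinM /= normrM normfV (gtr0_norm (gauss_weight_gt0 x)).
Qed.

Lemma integrable_Rd_mul k : measurable_fun setT k -> L1 k -> integrable_Rd (fun x => k x * w x).
Proof.
move=> mk /integrableP[_ ik].
have mg : measurable_fun setT (fun x => k x * w x).
  by apply: measurable_funM => //; exact: measurable_gauss_weight.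
split => //; rewrite iintE//; last first.
  by apply/measurable_EFinP; exact: measurableT_comp.
move: ik; congr (_ < _)%E; apply: eq_integral => x _.
rewrite -EFinM /= normrM (gtr0_norm (gauss_weight_gt0 x)) mulfK//.
by rewrite gt_eqF// gauss_weight_gt0.
Qed.

Lemma integrable_RdN g : integrable_Rd g -> integrable_Rd (fun x : d.-tuple R => - g x).
Proof.
move=> [mg ig]; split; first exact: measurableT_comp.
by move: ig; congr (_ < _)%E; apply: eq_iint => x; rewrite normrN.
Qed.

Lemma integrable_Rd_pos_div g : integrable_Rd g -> L1 (fun x => Num.max (g x) 0 / w x).
Proof.
move=> ig; have := integrable_funrpos measurableT (integrable_Rd_div ig).
apply: eq_integrable => // x _ /=; rewrite /funrpos.
by rewrite -[in LHS](mul0r (w x)^-1) maxr_pMl// invr_ge0 ltW// gauss_weight_gt0.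
Qed.

Lemma iint_pos_part f g : integrable_Rd g ->
  fine (iint (fun x => (Defs.sfun f x * Num.max (g x) 0)%:E)) =
  wpair (fun x => Num.max (g x) 0 / w x) f.
Proof.
move=> [mg _]; rewrite iintE.
- by congr fine; apply: eq_integral => x _; rewrite -EFinM mulrA.
- apply/measurable_EFinP; apply: measurable_funM; first exact: sfun_meas.
  exact: measurable_maxr.
- by move=> x; rewrite lee_fin mulr_ge0 ?sfun_ge0// le_max lexx orbT.
Qed.

Lemma wpairB k1 k2 f : L1 k1 -> L1 k2 ->
  wpair (fun x => k1 x - k2 x) f = wpair k1 f - wpair k2 f.
Proof.
move=> i1 i2; rewrite /wpair -RintegralB//; try exact: Sd_mulr_integrable.
by apply: eq_Rintegral => x _; rewrite mulrBr.
Qed.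

Lemma wpairD k1 k2 f : L1 k1 -> L1 k2 ->
  wpair (fun x => k1 x + k2 x) f = wpair k1 f + wpair k2 f.
Proof.
move=> i1 i2; rewrite /wpair -RintegralD//; try exact: Sd_mulr_integrable.
by apply: eq_Rintegral => x _; rewrite mulrDr.
Qed.

Lemma wpairZ c k f : L1 k -> wpair (fun x => c * k x) f = c * wpair k f.
Proof.
move=> ik; rewrite /wpair -RintegralZl//; last exact: Sd_mulr_integrable.
by apply: eq_Rintegral => x _; rewrite mulrCA.
Qed.

Lemma wpair_norm_le k f : L1 k -> `|wpair k f| <= \int[P]_x `|k x|.
Proof.
move=> ik; have ifk := Sd_mulr_integrable f ik.
apply: (le_trans (le_normr_Rintegral measurableT ifk)).
apply: le_Rintegral => //.
- exact: (integrable_norm ifk).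
- exact: (integrable_norm ik).
- by move=> x _; rewrite normrM ger0_norm ?sfun_ge0// ler_piMl// sfun_le1.
Qed.

Lemma pairingE f g : integrable_Rd g -> pairing f g = wpair (fun x => g x / w x) f.
Proof.
move=> ig; have igN := integrable_RdN ig.
rewrite /pairing iint_pos_part// (iint_pos_part _ igN) -wpairB//; last 2 first.
- exact: integrable_Rd_pos_div.
- exact: (integrable_Rd_pos_div igN).
congr wpair; apply/funext => x; rewrite -mulrBl; congr (_ / _).
by case: (lerP (g x) 0) => g0; case: (lerP (- g x) 0) => g1; lra.
Qed.

Lemma wpair_continuous k : L1 k -> continuous (wpair k).
Proof.
move=> ik f; apply/(@cvgrPdist_lt _ _ _ (nbhs f)) => e e0.
have mk : measurable_fun setT k by apply/measurable_EFinP; exact: measurable_int ik.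
have ig := integrable_Rd_mul mk ik.
have pE h : pairing h (fun x => k x * w x) = wpair k h.
  rewrite pairingE//; congr wpair; apply/funext => x.
  by rewrite mulfK// gt_eqF// gauss_weight_gt0.
exists [set h | `|wpair k f - wpair k h| < e]; split => //.
- move=> h /= he; exists 1%N, (fun _ x => k x * w x), (e - `|wpair k f - wpair k h|).
  split; first by rewrite subr_gt0.
  split=> // h' /(_ ord0); rewrite !pE => hh'.
  have := ler_distD (wpair k h) (wpair k f) (wpair k h').
  by rewrite [`|wpair k h - _|]distrC => /le_lt_trans; apply; rewrite -ltrBrDl.
- by rewrite /= subrr normr0.
Qed.

Lemma nbhs_wpair (f : Sd) (U : set Sd) : nbhs f U ->
  exists (n : nat) (k : 'I_n -> d.-tuple R -> R) (e : R),
    [/\ 0 < e, forall i, L1 (k i) &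
      forall h, (forall i, `|wpair (k i) h - wpair (k i) f| < e) -> U h].
Proof.
move=> [B [oB Bf BU]]; have [n [g [e [e0 [ig H]]]]] := oB f Bf.
exists n, (fun i x => g i x / w x), e; split => //.
- by move=> i; exact: integrable_Rd_div.
- by move=> h hh; apply/BU/H => i; rewrite !pairingE.
Qed.

End WeakTopology.

(** * Weak-* compactness *)

(** Compactness of the segment gives a cluster point. For an ultrafilter it is a limit: otherwise
    the complement of some ball around it would have large preimage, yet it would have to meet that
    ball. *)
Lemma ultra_cvg_bounded (R : realType) (T : Type) (F : set_system T) (u : T -> R) (M : R) :
  UltraFilter F -> (forall x, `|u x| <= M) -> exists l : R, u @ F --> l.
Proof.
move=> FU uM; have FP : ProperFilter F by exact: ultra_proper.
have := @segment_compact R (- M) M.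
move=> /(_ (u @ F) _) [].
  by apply: (@nearW _ F) => x; rewrite /= in_itv /= -ler_norml.
move=> l [_ cl]; exists l; apply/cvgrPdist_lt => e e0.
have [//|FC] := in_ultra_setVsetC [set x | `|l - u x| < e] FU.
have [y [/= + ly]] := cl (~` ball l e) (ball l e)
  (FC : (u @ F) (~` ball l e)) (nbhsx_ballx l e e0).
by [].
Qed.

(** Test the hypothesis on the set where [u] is negative: there the integral of [|u|] is both
    nonnegative and nonpositive. *)
Lemma integral_ge0_ae_ge0 (R : realType) (disp : measure_display) (T : measurableType disp)
    (mu : {measure set T -> \bar R}) (u : T -> R) :
  mu.-integrable setT (EFin \o u) ->
  (forall A, measurable A -> 0 <= \int[mu]_(x in A) (u x)%:E)%E ->
  {ae mu, forall x, 0 <= u x}.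
Proof.
move=> iu u0; have mu' : measurable_fun setT u by apply/measurable_EFinP; exact: measurable_int iu.
pose A := [set x | u x < 0].
have mA : measurable A.
  rewrite -[A]setTI (_ : A = u @^-1` `]-oo, 0[%classic); first exact: mu'.
  by apply/seteqP; split => x /=; rewrite in_itv.
have muA : measurable_fun A (EFin \o u) by exact/measurable_EFinP/measurable_funTS.
have := (ae_eq_integral_abs mu mA muA).1; case.
  under eq_integral => x xA.
    rewrite /= ltr0_norm; last by move: xA; rewrite inE.
    over.
  have Nu0 x : A x -> (0 <= (- u x)%:E)%E by move=> Ax; rewrite lee_fin oppr_ge0 ltW.
  apply/eqP; rewrite eq_le integral_ge0// andbT -oppe_ge0.
  rewrite -integral_ge0N//; apply: (le_trans (u0 A mA)).
  by under [leRHS]eq_integral do rewrite -EFinN opprK.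
move=> N [mN N0 AN]; exists N; split => // x /= /negP; rewrite -ltNge => ux.
by apply: AN => /= /(_ ux) /eqP; rewrite eqe lt_eqF.
Qed.

(* Along an ultrafilter, [A |-> lim \int_A h] is a finitely additive set function
   dominated by the probability [P], hence countably additive and absolutely
   continuous; its Radon-Nikodym density is the weak-* limit. *)
Section UltraLimit.
Variables (R : realType) (d : nat).
Local Notation Sd := (Defs.Sd R d).
Local Notation P := (gauss_prob R d).
Local Notation L1 k := (P.-integrable setT (EFin \o k)).
Variables (F : set_system Sd) (FU : UltraFilter F).

Let FP : ProperFilter F. Proof. exact: ultra_proper. Qed.

Let lam (k : d.-tuple R -> R) : R := lim (wpair k @ F).

Let lam_cvg k : L1 k -> wpair k @ F --> lam k.
Proof.
move=> ik.
by have [l] := ultra_cvg_bounded FU (fun h => wpair_norm_le h ik) => /cvgP.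
Qed.

Let lamE k l : wpair k @ F --> l -> lam k = l.
Proof. exact: cvg_lim. Qed.

Let lamD k1 k2 : L1 k1 -> L1 k2 -> lam (fun x => k1 x + k2 x) = lam k1 + lam k2.
Proof.
move=> i1 i2; apply: lamE; rewrite (_ : wpair _ = fun h => wpair k1 h + wpair k2 h).
  by apply: cvgD; exact: lam_cvg.
by apply/funext => h; exact: wpairD.
Qed.

Let lamB k1 k2 : L1 k1 -> L1 k2 -> lam (fun x => k1 x - k2 x) = lam k1 - lam k2.
Proof.
move=> i1 i2; apply: lamE; rewrite (_ : wpair _ = fun h => wpair k1 h - wpair k2 h).
  by apply: cvgB; exact: lam_cvg.
by apply/funext => h; exact: wpairB.
Qed.

Let lamZ c k : L1 k -> lam (fun x => c * k x) = c * lam k.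
Proof.
move=> i1; apply: lamE; rewrite (_ : wpair _ = fun h => c * wpair k h).
  by apply: cvgMl_tmp; exact: lam_cvg.
by apply/funext => h; exact: wpairZ.
Qed.

Let lam_norm_le k : L1 k -> `|lam k| <= \int[P]_x `|k x|.
Proof.
move=> ik; have cv : cvg (wpair k @ F) by apply/cvg_ex; exists (lam k); exact: lam_cvg.
have bnd h : - (\int[P]_x `|k x|) <= wpair k h <= \int[P]_x `|k x|.
  by rewrite -ler_norml wpair_norm_le.
rewrite ler_norml; apply/andP; split; [apply: limr_ge|apply: limr_le] => //;
by apply: nearW => h; have /andP[] := bnd h.
Qed.

Let L1_indic A : measurable A -> L1 (\1_A).
Proof. by move=> mA; apply: integrable_indic => //; rewrite ltey_eq fin_num_measure. Qed.

Let Rintegral_indic A : measurable A -> \int[P]_x `|\1_A x| = fine (P A).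
Proof.
move=> mA; under eq_Rintegral do rewrite ger0_norm//.
by rewrite /Rintegral integral_indic// setIT.
Qed.

Let lam_indic_ge0 A : measurable A -> 0 <= lam (\1_A).
Proof.
move=> mA; apply: limr_ge; first by apply/cvg_ex; exists (lam (\1_A)); exact/lam_cvg/L1_indic.
by apply: nearW => h; apply: Rintegral_ge0 => x _; rewrite mulr_ge0 ?sfun_ge0.
Qed.

Let nu (A : set (d.-tuple R)) : \bar R := (lam (\1_A))%:E.

Let nu0 : nu set0 = 0%E.
Proof.
rewrite /nu; congr EFin; apply/eqP; rewrite -normr_le0.
by rewrite (le_trans (lam_norm_le (L1_indic measurable0)))// Rintegral_indic// measure0.
Qed.

Let nu_fin A : measurable A -> nu A \is a fin_num.
Proof. by []. Qed.

Let lam_setU A B : measurable A -> measurable B -> [disjoint A & B] ->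
  lam (\1_(A `|` B)) = lam (\1_A) + lam (\1_B).
Proof.
move=> mA mB AB; rewrite -lamD; try exact: L1_indic.
congr lam; apply/funext => x; rewrite !indicE in_setU.
case: (boolP (x \in A)) => xA; case: (boolP (x \in B)) => xB; rewrite /= ?addr0 ?add0r//.
suff : set0 x by [].
by move/disj_set2P: AB => <-; split; apply/set_mem.
Qed.

Let nu_additive : semi_sigma_additive nu.
Proof.
move=> A mA tA mUA.
have mUn n : measurable (\big[setU/set0]_(i < n) A i) by exact: bigsetU_measurable.
have sumE n : \sum_(i < n) lam (\1_(A i)) = lam (\1_(\big[setU/set0]_(i < n) A i)).
  elim: n => [|n IH]; first by rewrite !big_ord0; have [] := nu0.
  rewrite !big_ord_recr /= lam_setU ?IH//; first exact: mUn.
  by apply/disj_set2P/(@trivIset_bigsetUI _ predT) => //; rewrite /predT /= trueE.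
(* The n-th partial sum misses [lam] of the tail [B n], which is at most [P (B n)] and so tends to
   0. *)
pose B n := (\bigcup_i A i) `\` \big[setU/set0]_(i < n) A i.
have mB n : measurable (B n) by exact: measurableD.
have split_n n : lam (\1_(\bigcup_i A i)) = \sum_(i < n) lam (\1_(A i)) + lam (\1_(B n)).
  rewrite sumE -lam_setU//.
    by rewrite setDUK//; exact: bigsetU_bigcup.
  by rewrite /B disj_set2E setDIK.
have PB n : fine (P (B n)) = fine (P (\bigcup_i A i)) - fine (\sum_(0 <= i < n) P (A i))%E.
  rewrite /B measureD// ?ltey_eq ?fin_num_measure//.
  rewrite setIidr; last exact: bigsetU_bigcup.
  rewrite fineB ?fin_num_measure//; congr (_ - fine _).
  rewrite big_mkord; apply: measure_semi_additive => //.
have PB0 : fine (P (B n)) @[n --> \oo] --> 0.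
  rewrite -(subrr (fine (P (\bigcup_i A i)))); under eq_fun do rewrite PB.
  apply: cvgB; first exact: cvg_cst.
  apply: fine_cvg; rewrite fineK ?fin_num_measure//.
  exact: measure_semi_sigma_additive.
apply/fine_cvgP; split; first by apply: nearW => n; apply/sum_fin_numP.
rewrite [X in X @ \oo --> _](_ : _ = fun n => lam (\1_(\bigcup_i A i)) - lam (\1_(B n))).
  rewrite -[X in _ --> X]subr0; apply: cvgB; first exact: cvg_cst.
  apply: (@squeeze_cvgr _ _ _ _ (fun n => - fine (P (B n))) (fun n => fine (P (B n)))) => //.
    apply: nearW => n; rewrite -ler_norml -Rintegral_indic//.
    exact: lam_norm_le (L1_indic _).
  by rewrite -oppr0; exact: cvgN.
apply/funext => n; rewrite /= big_mkord sumEFin /= (split_n n); ring.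
Qed.

HB.instance Definition _ := isCharge.Build _ _ _ nu nu0 nu_fin nu_additive.

Let nu_dom : nu `<< P.
Proof.
apply/null_content_dominatesP => A mA A0; rewrite /nu; congr EFin.
apply/eqP; rewrite -normr_le0.
by rewrite (le_trans (lam_norm_le (L1_indic mA)))// Rintegral_indic// A0.
Qed.

Let r : d.-tuple R -> \bar R := Radon_Nikodym nu P.
Let rr x := fine (r x).

Let r_EFin x : r x = (rr x)%:E.
Proof. by rewrite fineK// Radon_Nikodym_fin_num. Qed.

Let rr_integrable : L1 rr.
Proof.
have := Radon_Nikodym_integrable nu_dom; congr (P.-integrable _ _).
by apply/funext => x; exact: r_EFin.
Qed.

Let rr_int A : measurable A -> (\int[P]_(x in A) (rr x)%:E)%E = (lam (\1_A))%:E.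
Proof.
move=> mA; rewrite -/(nu A) (Radon_Nikodym_integral nu_dom mA).
by apply: eq_integral => x _; rewrite -r_EFin.
Qed.

Let rr_ge0 : {ae P, forall x, 0 <= rr x}.
Proof.
by apply: integral_ge0_ae_ge0 => // A mA; rewrite rr_int// lee_fin lam_indic_ge0.
Qed.

Let rr_le1 : {ae P, forall x, rr x <= 1}.
Proof.
have i1 : L1 (fun=> 1 : R) by exact: finite_measure_integrable_cst.
have : {ae P, forall x, 0 <= 1 - rr x}.
  apply: integral_ge0_ae_ge0; first exact: (integrableB measurableT i1 rr_integrable).
  move=> A mA; under eq_integral do rewrite EFinB.
  rewrite integralB_EFin//; try exact: (integrableS measurableT).
  rewrite rr_int// (_ : (\int[P]_(_ in A) 1)%E = (fine (P A))%:E); last first.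
    by rewrite integral_cst// mul1e fineK ?fin_num_measure.
  rewrite -EFinB lee_fin subr_ge0 -(Rintegral_indic mA).
  exact: le_trans (ler_norm _) (lam_norm_le (L1_indic mA)).
by apply: filterS => x; rewrite subr_ge0.
Qed.

Let m_rr : measurable_fun setT rr.
Proof. by apply/measurable_EFinP; exact: measurable_int rr_integrable. Qed.

(** The density lies in [0,1] only almost everywhere, whereas [Sd] demands it at every point. *)
Let clamp x := Num.min (Num.max (rr x) 0) 1.

Let m_clamp : measurable_fun setT clamp.
Proof.
apply: measurable_minr; last exact: measurable_cst.
by apply: measurable_maxr.
Qed.

Let clamp_ge0 x : 0 <= clamp x.
Proof. by rewrite le_min ler01 le_max lexx orbT. Qed.

Let clamp_le1 x : clamp x <= 1.
Proof. by rewrite ge_min lexx orbT. Qed.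

Let fl : Sd := MkSd m_clamp clamp_ge0 clamp_le1.

Let clamp_ae : {ae P, forall x, clamp x = rr x}.
Proof.
by apply: filterS2 rr_ge0 rr_le1 => x h0 h1; rewrite /clamp max_l// min_l.
Qed.

Let lam_fl_indic A : measurable A -> lam (\1_A) = wpair (\1_A) fl.
Proof.
move=> mA; apply: EFin_inj; rewrite -rr_int// /wpair /Rintegral fineK; last first.
  by apply: integrable_fin_num => //; exact: Sd_mulr_integrable (L1_indic mA).
rewrite [LHS]integral_mkcond; apply: ae_eq_integral => //.
- by apply/(measurable_restrictT _ _).1 => //; exact/measurable_EFinP/measurable_funTS.
- apply/measurable_EFinP; apply: measurable_funM => //; exact: measurable_indic.
- apply: filterS clamp_ae => x hx _ /=; rewrite patchE indicE hx.
  by case: ifP => _; rewrite ?mulr1 ?mulr0.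
Qed.

Import HBSimple.

(** An arbitrary list of values and an arbitrary family of sets make induction on the list possible;
    a simple function is the instance given by its range and its fibres. *)
Let lam_fl_sum (s : seq R) (A : R -> set (d.-tuple R)) : (forall y, measurable (A y)) ->
  let k x := \sum_(y <- s) y * \1_(A y) x in L1 k /\ lam k = wpair k fl.
Proof.
move=> mA; elim: s => [|y s [iL IH]] /=.
  have E : (fun x : d.-tuple R => \sum_(y <- [::]) y * \1_(A y) x) = (fun x => 0 * \1_set0 x : R).
    by apply/funext => x; rewrite big_nil mul0r.
  rewrite E; split.
    by apply: (@integrableZl _ _ _ P _ measurableT 0 (EFin \o \1_set0)); exact: L1_indic.
  by rewrite lamZ ?wpairZ; [rewrite !mul0r|exact: L1_indic|exact: L1_indic].
have iy : L1 (fun x => y * \1_(A y) x).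
  by apply: (@integrableZl _ _ _ P _ measurableT y (EFin \o \1_(A y))); exact: L1_indic.
have E : (fun x : d.-tuple R => \sum_(z <- y :: s) z * \1_(A z) x) =
   (fun x => y * \1_(A y) x + \sum_(z <- s) z * \1_(A z) x).
  by apply/funext => x; rewrite big_cons.
rewrite E; split; first exact: (integrableD measurableT iy iL).
rewrite lamD// wpairD// -IH lamZ ?wpairZ ?lam_fl_indic//; exact: L1_indic.
Qed.

Let lam_fl_sfun (g : {sfun d.-tuple R >-> R}) : lam g = wpair g fl.
Proof.
have [] := @lam_fl_sum (finmap.enum_fset (fset_set (range g))) (fun y => g @^-1` [set y]) _.
  by move=> y; exact: measurable_funPTI.
suff -> : (fun x => \sum_(y <- finmap.enum_fset (fset_set (range g)))
    y * \1_(g @^-1` [set y]) x) = g by [].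
apply/funext => x; rewrite [RHS]fimfunE fsbig_finite//.
Qed.

(** Both sides are bounded by the L1 norm of [k] and agree on simple functions, which are dense in
    L1. *)
Let lam_fl k : L1 k -> lam k = wpair k fl.
Proof.
move=> ik; have [g [ig _ gk]] := approximation_sfun_integrable measurableT ik.
apply/eqP; rewrite -subr_eq0 -normr_le0; apply/ler_addgt0Pl => e e0.
rewrite addr0.
have e20 : 0 < e / 2 by rewrite divr_gt0.
have /fine_cvgP[_ /cvgrPdist_lt /(_ _ e20)] := gk.
case=> n _ /(_ n (leqnn n)) /=.
rewrite sub0r normrN => hn.
have ikg : L1 (fun x => k x - g n x) by exact: (integrableB measurableT ik (ig n)).
have hn' : \int[P]_x `|k x - g n x| < e / 2 by exact: le_lt_trans (ler_norm _) hn.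
have -> : lam k - wpair k fl = lam (fun x => k x - g n x) - wpair (fun x => k x - g n x) fl.
  by rewrite lamB// wpairB// lam_fl_sfun; ring.
apply: (le_trans (ler_normB _ _)); rewrite (splitr e); apply: lerD.
  exact: le_trans (lam_norm_le ikg) (ltW hn').
exact: le_trans (wpair_norm_le _ ikg) (ltW hn').
Qed.

Lemma ultra_cvg_Sd : exists f : Sd, F --> f.
Proof.
exists fl => U /nbhs_wpair[n [k [e [e0 ik H]]]].
apply: (filterS H); apply: filter_forall => i.
have := lam_cvg (ik i); rewrite lam_fl// => /cvgrPdist_lt/(_ _ e0).
by apply: filterS => h /=; rewrite distrC.
Qed.

End UltraLimit.

Lemma Sd_compact (R : realType) (d : nat) : compact [set: Defs.Sd R d].
Proof.
rewrite compact_ultra => F FU _.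
by have [f Ff] := ultra_cvg_Sd FU; exists f.
Qed.

(** * A countable base of cozero sets *)

Section ContinuousFunctions.
Variables (R : realType) (T : topologicalType).
Implicit Types f g : T -> R.

Lemma continuous_cst_fun (c : R) : continuous (fun _ : T => c).
Proof. by move=> x; exact: cvg_cst. Qed.

Lemma continuous_min_fun f g : continuous f -> continuous g ->
  continuous (fun x => Num.min (f x) (g x)).
Proof. by move=> cf cg x; exact: (@continuous_min R T f g x (cf x) (cg x)). Qed.

Lemma continuous_max_fun f g : continuous f -> continuous g ->
  continuous (fun x => Num.max (f x) (g x)).
Proof. by move=> cf cg x; exact: (@continuous_max R T f g x (cf x) (cg x)). Qed.

Lemma continuousD_fun f g : continuous f -> continuous g ->
  continuous (fun x => f x + g x).
Proof. by move=> cf cg x; apply: cvgD; [exact: cf|exact: cg]. Qed.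

Lemma continuousB_fun f g : continuous f -> continuous g ->
  continuous (fun x => f x - g x).
Proof. by move=> cf cg x; apply: cvgB; [exact: cf|exact: cg]. Qed.

Lemma continuousM_fun f g : continuous f -> continuous g ->
  continuous (fun x => f x * g x).
Proof. by move=> cf cg x; apply: cvgM; [exact: cf|exact: cg]. Qed.

Lemma continuousZ_fun c f : continuous f -> continuous (fun x => c * f x).
Proof. by move=> cf; apply: continuousM_fun => //; exact: continuous_cst_fun. Qed.

Lemma continuousN_fun f : continuous f -> continuous (fun x => - f x).
Proof. by move=> cf x; apply: cvgN; exact: cf. Qed.

Lemma continuous_sum_fun (I : Type) (s : seq I) (F : I -> T -> R) :
  (forall i, continuous (F i)) -> continuous (fun x => \sum_(i <- s) F i x).
Proof.
move=> cF; elim: s => [|i s IH].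
  rewrite (_ : (fun _ => _) = (fun _ => 0)); first exact: continuous_cst_fun.
  by apply/funext => x; rewrite big_nil.
rewrite (_ : (fun _ => _) = (fun x => F i x + \sum_(j <- s) F j x)).
  exact: continuousD_fun.
by apply/funext => x; rewrite big_cons.
Qed.

Lemma open_gt0 f : continuous f -> open [set x | 0 < f x].
Proof.
move=> /continuousP cf; rewrite (_ : [set _ | _] = f @^-1` [set y | 0 < y]).
  by apply: cf; exact: open_gt.
by [].
Qed.

End ContinuousFunctions.

Section Separability.
Variables (R : realType) (d : nat).
Local Notation Sd := (Defs.Sd R d).
Local Notation P := (gauss_prob R d).
Local Notation L1 k := (P.-integrable setT (EFin \o k)).

(** The case [None] adds the whole space, whose mass is needed for complements in the Dynkin
    induction. *)
Definition orthant (q : option (d.-tuple rat)) : set (d.-tuple R) :=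
  if q is Some q then [set x | forall i, tnth x i < ratr (tnth q i)] else setT.

Lemma orthant_measurable q : measurable (orthant q).
Proof.
case: q => [q|] //=.
rewrite (_ : [set x | _] =
    \bigcap_(i in [set: 'I_d]) ((@tnth d R ^~ i) @^-1` `]-oo, ratr (tnth q i)[)).
  apply: fin_bigcap_measurable => // i _; rewrite -[_ @^-1` _]setTI.
  exact: measurable_tnth.
apply/seteqP; split => x /= h i; last by have := h i I; rewrite /= in_itv.
by move=> _; rewrite /= in_itv /=; exact: h.
Qed.

Lemma orthant_setI : setI_closed (range orthant).
Proof.
move=> _ _ [[q|] _ <-] [[q'|] _ <-] /=; rewrite ?setIT ?setTI; last 3 first.
- by exists (Some q).
- by exists (Some q').
- by exists None.
exists (Some [tuple Num.min (tnth q i) (tnth q' i) | i < d]) => //=.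
apply/seteqP; split => [x h|x [h h'] i].
  by split=> i; have := h i; rewrite tnth_mktuple; case: (leP (tnth q i) (tnth q' i)) => qq';
    move=> /lt_le_trans; apply; rewrite ler_rat// ltW.
by rewrite tnth_mktuple; case: (leP (tnth q i) (tnth q' i)).
Qed.

(** The identity out of the generated sigma-algebra is measurable as soon as its coordinates are, so
    only half-spaces have to be written as countable unions of orthants. *)
Lemma orthant_measurableE : (@measurable _ (d.-tuple R)) = <<s range orthant >>.
Proof.
apply/seteqP; split; last first.
  apply: smallest_sub; first exact: sigma_algebra_measurable.
  by move=> _ [q _ <-]; exact: orthant_measurable.
pose T' : measurableType _ := g_sigma_algebraType (range orthant).
have mid : measurable_fun [set: T'] (id : T' -> d.-tuple R).
  apply/measurable_fun_tnthP => i.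
  apply: (measurability _ (RGenInftyO.measurableE R)) => _ [_ [r ->] <-].
  rewrite setTI.
  (* The half-space where coordinate i is below [r] is exhausted by orthants whose i-th corner is a
     rational [q <= r] and whose other corners are a large integer [m]. *)
  pose F (q : rat) : set T' := if ratr q <= r then
    \bigcup_m orthant (Some [tuple if j == i then q else m%:R | j < d]) else set0.
  rewrite (_ : _ @^-1` _ = \bigcup_q F q).
    apply: bigcupT_measurable_rat => q; rewrite /F; case: ifP => // _.
    apply: bigcupT_measurable => m; apply: sub_sigma_algebra.
    by exists (Some [tuple if j == i then q else m%:R | j < d]).
  apply/seteqP; split => [x /=|x [q _]].
  - rewrite in_itv/= => xr; have [q] := rat_in_itvoo xr; rewrite in_itv/= => /andP[xq qr].
    exists q => //; rewrite /F ltW//.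
    have [m mP] : exists m : nat, forall j, tnth x j < m%:R.
      exists (\max_(j < d) Num.bound `|tnth x j|)%N => j.
      apply: (le_lt_trans (ler_norm _)).
      have h := archi_boundP (normr_ge0 (tnth x j)).
      apply: (lt_le_trans h); rewrite ler_nat.
      exact: (leq_bigmax (F := fun j : 'I_d => Num.bound `|tnth x j|)).
    exists m => // j; rewrite tnth_mktuple; case: eqP => [->//|_].
    by rewrite ratr_nat.
  - rewrite /F; case: ifP => // qr [m _ /(_ i)]; rewrite tnth_mktuple eqxx => xq.
    by rewrite /= in_itv/= (lt_le_trans xq).
by move=> A mA; have := mid measurableT A mA; rewrite setTI.
Qed.

(** The orthants form a generating pi-system, so equal masses on them force [f] and [h] to agree
    almost everywhere. Hence countably many test functions determine all pairings. *)
Lemma wpair_orthant_inj (f h : Sd) :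
  (forall q, wpair (\1_(orthant q)) f = wpair (\1_(orthant q)) h) ->
  forall k, L1 k -> wpair k f = wpair k h.
Proof.
move=> fh.
have if1 (g : Sd) : L1 (Defs.sfun g).
  have i1 : L1 (fun=> 1 : R) by exact: finite_measure_integrable_cst.
  have := Sd_mulr_integrable g i1; congr (_.-integrable _ _).
  by apply/funext => x /=; rewrite mulr1.
have wE (g : Sd) A : measurable A -> (\int[P]_(x in A) (Defs.sfun g x)%:E)%E = (wpair (\1_A) g)%:E.
  move=> mA; rewrite /wpair /Rintegral fineK.
    rewrite [LHS]integral_mkcond; apply: eq_integral => x _; rewrite patchE indicE.
    by case: ifP; rewrite ?mulr1 ?mulr0.
  apply: integrable_fin_num => //; apply: Sd_mulr_integrable.
  by apply: integrable_indic => //; rewrite ltey_eq fin_num_measure.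
pose D A :=
  (\int[P]_(x in A) (Defs.sfun f x)%:E = \int[P]_(x in A) (Defs.sfun h x)%:E)%E.
have fhA A : measurable A -> D A.
  rewrite orthant_measurableE.
  apply: (@dynkin_induction _ _ _ D orthant_measurableE orthant_setI); rewrite /D.
  - by rewrite (wE _ _ (orthant_measurable None)) fh -wE//; exact: (orthant_measurable None).
  - by move=> _ [q _ <-]; rewrite !wE ?fh//; exact: orthant_measurable.
  - move=> A' mA' E.
    have S (g : Sd) : (\int[P]_(x in ~` A') (Defs.sfun g x)%:E =
        \int[P]_x (Defs.sfun g x)%:E - \int[P]_(x in A') (Defs.sfun g x)%:E)%E.
      rewrite -(setvU A') integral_setU//; last 3 first.
      + exact: measurableC.
      + by rewrite setvU; apply/measurable_EFinP; exact: sfun_meas.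
      + by rewrite disj_set2E setICl.
      rewrite addeK// wE//.
    rewrite !S E; congr (_ - _)%E.
    by rewrite (wE _ _ (orthant_measurable None)) fh -wE//; exact: (orthant_measurable None).
  - move=> A' mA' tA' E.
    have iA (g : Sd) : P.-integrable (\bigcup_k A' k) (EFin \o Defs.sfun g).
      apply: integrableS (if1 g) => //; exact: bigcupT_measurable.
    rewrite (integral_bigcup tA' mA' (iA f)) (integral_bigcup tA' mA' (iA h)).
    by apply: eq_eseriesr => i _; exact: E.
have ae : ae_eq P setT (EFin \o Defs.sfun f) (EFin \o Defs.sfun h).
  apply: (integral_ae_eq measurableT (if1 f)).
  - by apply/measurable_EFinP; exact: sfun_meas.
  - by move=> E _ mE; exact: fhA.
move=> k ik; rewrite /wpair /Rintegral; congr fine; apply: ae_eq_integral => //.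
- exact: measurable_int (Sd_mulr_integrable f ik).
- exact: measurable_int (Sd_mulr_integrable h ik).
- by apply: filterS ae => x /(_ I) [] fx _; rewrite fx.
Qed.

Definition orthant_mass q (h : Sd) : R := wpair (\1_(orthant q)) h.

Lemma orthant_mass_continuous q : continuous (orthant_mass q).
Proof.
apply: wpair_continuous; apply: integrable_indic; first exact: orthant_measurable.
Qed.

(** Basic open sets are encoded by continuous functions positive exactly on them, because a
    functional can be evaluated on such functions; rational endpoints keep the family countable. *)
Definition tent (t : option (d.-tuple rat) * (rat * rat)) (h : Sd) : R :=
  Num.max 0 (Num.min (orthant_mass t.1 h - ratr t.2.1) (ratr t.2.2 - orthant_mass t.1 h)).

Definition bump l (h : Sd) : R := foldr (fun t => Num.min (tent t h)) 1 l.

Lemma bump_continuous l : continuous (bump l).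
Proof.
elim: l => [|t l IH]; first exact: continuous_cst_fun.
apply: continuous_min_fun IH; apply: continuous_max_fun.
  exact: continuous_cst_fun.
by apply: continuous_min_fun; apply: continuousB_fun;
  by [exact: continuous_cst_fun|exact: orthant_mass_continuous].
Qed.

Lemma bump_ge0 l h : 0 <= bump l h.
Proof.
by elim: l => [|t l IH] /=; rewrite ?ler01// le_min IH andbT le_max lexx.
Qed.

Lemma bump_gt0 l h : (0 < bump l h) =
  all (fun t => ratr t.2.1 < orthant_mass t.1 h < ratr t.2.2) l.
Proof.
elim: l => [|t l IH] /=; first exact: ltr01.
by rewrite lt_min IH; congr (_ && _); rewrite lt_max ltxx/= lt_min !subr_gt0.
Qed.

(* Compactness: otherwise the sets [bump l > 0] with [bump l f > 0] accumulate at
   some [h] outside [U] with the same masses as [f] on all rational orthants, which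
   no open set separates from [f]. *)
Lemma bump_base (U : set Sd) f : open U -> U f ->
  exists l, 0 < bump l f /\ forall h, 0 < bump l h -> U h.
Proof.
move=> oU Uf; apply: contrapT => noU.
pose S l : set Sd := [set h | 0 < bump l h /\ ~ U h].
pose F := filter_from [set l | 0 < bump l f] S.
have FF : ProperFilter F.
  apply: filter_from_proper.
    apply: filter_from_filter; first by exists [::]; rewrite /= ltr01.
    move=> l l' lf l'f; exists (l ++ l').
      by move: lf l'f; rewrite /= !bump_gt0 all_cat => -> ->.
    move=> h [] /=; rewrite !bump_gt0 all_cat => /andP[lh l'h] Uh.
    by split; split => //; rewrite bump_gt0.
  move=> l lf; apply: contrapT => nS; apply: noU; exists l; split => // h lh.
  by apply: contrapT => Uh; apply: nS; exists h.
have [h [_ hcl]] := @Sd_compact R d F FF filterT.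
suff hf : forall q, orthant_mass q f = orthant_mass q h.
  have Uh : U h.
    have [n [k [e [e0 ik H]]]] := nbhs_wpair (open_nbhs_nbhs (conj oU Uf)).
    by apply: H => i; rewrite (wpair_orthant_inj hf (ik i)) subrr normr0.
  have FS : F (S [::]) by exists [::] => //=; exact: ltr01.
  by have [g [[_ Ug] /Ug]] := hcl (S [::]) U FS (open_nbhs_nbhs (conj oU Uh)).
move=> q; apply/eqP; apply: contrapT => /negP neq.
(* With half the gap as radius, the intervals around the masses of [f] and of [h] are disjoint. *)
have [e e0 eE] : exists2 e, 0 < e & 2 * e = `|orthant_mass q f - orthant_mass q h|.
  exists (`|orthant_mass q f - orthant_mass q h| / 2); last by field.
  by rewrite divr_gt0// normr_gt0 subr_eq0.
have [a] := @rat_in_itvoo R (orthant_mass q f - e) (orthant_mass q f) ltac:(lra).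
have [b] := @rat_in_itvoo R (orthant_mass q f) (orthant_mass q f + e) ltac:(lra).
rewrite !in_itv/= => /andP[b1 b2] /andP[a1 a2].
have Fl : F (S [:: (q, (a, b))]).
  by exists [:: (q, (a, b))] => //=; rewrite -[_ _ 1]/(bump [:: (q, (a, b))] f) bump_gt0 /= a2 b1.
have nh := (@cvgrPdist_lt _ _ _ (nbhs h) _ _ _).1 (@orthant_mass_continuous q h) e e0.
have [g []] := hcl _ _ Fl (nh (nbhs_filter h)).
rewrite /S /= -[_ _ 1]/(bump [:: (q, (a, b))] g) bump_gt0 /= andbT => -[/andP[g1 g2] _].
rewrite ltr_norml => /andP[g3 g4].
have [h0|h0] := leP 0 (orthant_mass q f - orthant_mass q h).
  by rewrite ger0_norm// in eE; lra.
by rewrite ltr0_norm// in eE; lra.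
Qed.

(** An integer that codes no list gives the zero function, whose positivity set is empty and thus
    harmless in a base. *)
Definition base_bump (n : nat) : Sd -> R := if unpickle n is Some l then bump l else cst 0.

Lemma base_bump_continuous n : continuous (base_bump n).
Proof.
by rewrite /base_bump; case: unpickle => [l|]; [exact: bump_continuous|exact: continuous_cst_fun].
Qed.

Lemma base_bump_ge0 n h : 0 <= base_bump n h.
Proof. by rewrite /base_bump; case: unpickle => [l|//]; exact: bump_ge0. Qed.

Lemma base_bumpP (U : set Sd) f : open U -> U f ->
  exists n, 0 < base_bump n f /\ forall h, 0 < base_bump n h -> U h.
Proof.
move=> oU Uf; have [l lP] := bump_base oU Uf.
by exists (pickle l); rewrite /base_bump pickleK.
Qed.

End Separability.

(** * Extreme Hahn-Banach functionals *)

Section ExtremeHahnBanach.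
Variables (R : realType) (V : lmodType R) (E : set V).
Hypotheses (E0 : E 0) (ED : forall u v, E u -> E v -> E (u + v))
  (EZ : forall (c : R) u, E u -> E (c *: u)).
Implicit Types (p q : V -> R) (u v : V).

(** Homogeneity is required as an inequality for positive scalars, the form that infima inherit
    directly; [sublinear_onZ] recovers equality by using the inverse scalar. *)
Definition sublinear_on q :=
  (forall u v, E u -> E v -> q (u + v) <= q u + q v) /\
  (forall (c : R) u, 0 < c -> E u -> q (c *: u) <= c * q u).

Definition linear_on q :=
  (forall u v, E u -> E v -> q (u + v) = q u + q v) /\
  (forall (c : R) u, E u -> q (c *: u) = c * q u).

Definition le_on q1 q2 := forall u, E u -> q1 u <= q2 u.

Lemma submodN u : E u -> E (- u).
Proof. by move=> Eu; rewrite -scaleN1r; exact: EZ. Qed.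

Lemma sublinear_on0 q : sublinear_on q -> q 0 = 0.
Proof.
move=> [_ qZ].
have := qZ 2 0 ltac:(lra) E0; have := qZ 2^-1 0 ltac:(lra) E0.
by rewrite !scaler0 => h1 h2; apply/eqP; rewrite eq_le; apply/andP; split; lra.
Qed.

Lemma sublinear_onZ q (c : R) u : sublinear_on q -> 0 <= c -> E u -> q (c *: u) = c * q u.
Proof.
move=> sq; rewrite le0r => /orP[/eqP -> _|c0 Eu].
  by rewrite scale0r mul0r sublinear_on0.
have [_ qZ] := sq; apply/eqP; rewrite eq_le qZ//=.
have c0' : 0 < c^-1 by rewrite invr_gt0.
have := qZ c^-1 (c *: u) c0' (EZ c Eu).
by rewrite scalerA mulVf ?gt_eqF// scale1r -ler_pdivrMl ?invrK.
Qed.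

Lemma sublinear_on_oppr_ge q u : sublinear_on q -> E u -> - q u <= q (- u).
Proof.
move=> sq Eu; have := sq.1 _ _ Eu (submodN Eu).
by rewrite subrr sublinear_on0// addrC -lerBlDr sub0r.
Qed.

(** This serves three infima: the one in [max_face], the one along a chain in Zorn's lemma, and
    [upper_mean]. They differ only in the index [k] that dominates two given ones. *)
Lemma sublinear_on_inf (I : Type) (D : set I) (Q : I -> V -> R) :
  D !=set0 ->
  (forall i j u v, D i -> D j -> E u -> E v -> exists2 k, D k & Q k (u + v) <= Q i u + Q j v) ->
  (forall i (c : R) u, D i -> 0 < c -> E u -> exists2 k, D k & Q k (c *: u) <= c * Q i u) ->
  (forall u, E u -> exists m, forall i, D i -> m <= Q i u) ->
  sublinear_on (fun u => inf [set Q i u | i in D]).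
Proof.
move=> [i0 Di0] QD QZ Qm.
have hasinf u : E u -> has_inf [set Q i u | i in D].
  move=> Eu; split; first by exists (Q i0 u), i0.
  by have [m mQ] := Qm u Eu; exists m => _ [i Di <-]; exact: mQ.
have lei u i : E u -> D i -> inf [set Q i u | i in D] <= Q i u.
  by move=> Eu Di; apply: ge_inf; [exact: (hasinf u Eu).2|exists i].
split=> [u v Eu Ev|c u c0 Eu].
  apply/ler_addgt0Pr => e e0.
  have e2 : 0 < e / 2 by rewrite divr_gt0.
  have [_ [i Di <-] Qi] := inf_adherent e2 (hasinf u Eu).
  have [_ [j Dj <-] Qj] := inf_adherent e2 (hasinf v Ev).
  have [k Dk Qk] := QD i j u v Di Dj Eu Ev.
  by have := lei _ _ (ED Eu Ev) Dk; lra.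
have c0' : 0 < c^-1 by rewrite invr_gt0.
rewrite -ler_pdivrMl//; apply: lb_le_inf; first by exists (Q i0 u), i0.
move=> _ [i Di <-]; rewrite ler_pdivrMl//.
have [k Dk Qk] := QZ i c u Di c0 Eu.
exact: le_trans (lei _ _ (EZ c Eu) Dk) Qk.
Qed.

Variable p : V -> R.
Hypothesis sp : sublinear_on p.

(* [q] represents a face of the set of linear functionals dominated by [p]. *)
Definition face q := [/\ sublinear_on q, le_on q p &
  forall (a : R) L1 L2, 0 < a < 1 -> linear_on L1 -> linear_on L2 ->
    le_on L1 p -> le_on L2 p -> le_on (fun u => a * L1 u + (1 - a) * L2 u) q ->
    le_on L1 q].

(* The functional of the subface on which [v] takes its maximal value [q v]. *)
Definition max_face q v : V -> R :=
  fun u => inf [set q (u + s *: v) - s * q v | s in [set s : R | 0 <= s]].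

Section MaxFace.
Variables (q : V -> R) (v : V).
Hypotheses (sq : sublinear_on q) (Ev : E v).

Let lower u s : E u -> 0 <= s -> - q (- u) <= q (u + s *: v) - s * q v.
Proof.
move=> Eu s0; have := sq.1 _ _ (ED Eu (EZ s Ev)) (submodN Eu).
by rewrite addrAC subrr add0r (sublinear_onZ sq s0 Ev); lra.
Qed.

Let lei u s : E u -> 0 <= s -> max_face q v u <= q (u + s *: v) - s * q v.
Proof.
move=> Eu s0; apply: ge_inf; last by exists s.
by exists (- q (- u)) => _ [t t0 <-]; exact: lower.
Qed.

Lemma max_face_sublinear : sublinear_on (max_face q v).
Proof.
apply: sublinear_on_inf; first by exists 0 => /=.
- move=> s t u u' /= s0 t0 Eu Eu'; exists (s + t); first exact: addr_ge0.
  have := sq.1 _ _ (ED Eu (EZ s Ev)) (ED Eu' (EZ t Ev)).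
  by rewrite addrACA -scalerDl mulrDl; lra.
- move=> s c u /= s0 c0 Eu; exists (c * s); first by rewrite mulr_ge0// ltW.
  have := sq.2 c _ c0 (ED Eu (EZ s Ev)).
  by rewrite scalerDr scalerA mulrBr mulrA; lra.
- by move=> u Eu; exists (- q (- u)) => s s0; exact: lower.
Qed.

Lemma max_face_le : le_on (max_face q v) q.
Proof. by move=> u Eu; have := lei Eu (lexx 0); rewrite scale0r addr0 mul0r subr0. Qed.

Lemma max_faceN : max_face q v (- v) <= - q v.
Proof.
have := lei (submodN Ev) ler01; rewrite scale1r addNr (sublinear_on0 sq) mul1r.
by rewrite sub0r.
Qed.

End MaxFace.

(** A combination below [max_face q v] is at least [q v] at [v], while neither component exceeds
    [q v] there. So [L1 v = q v], and replacing [u] by [u + s *: v] in [L1 u <= q u] gives the bound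
    by the infimum. *)
Lemma face_max_face q v : face q -> E v -> face (max_face q v).
Proof.
move=> [sq qp Fq] Ev; split; first exact: max_face_sublinear.
  by move=> u Eu; exact: le_trans (max_face_le sq Ev Eu) (qp u Eu).
move=> a L1 L2 a01 l1 l2 L1p L2p L12.
have L12q : le_on (fun u => a * L1 u + (1 - a) * L2 u) q.
  by move=> u Eu; exact: le_trans (L12 u Eu) (max_face_le sq Ev Eu).
have L1q := Fq a L1 L2 a01 l1 l2 L1p L2p L12q.
have L2q : le_on L2 q.
  apply: (Fq (1 - a) L2 L1) => //; first by move/andP: a01 => [? ?]; apply/andP; split; lra.
  by move=> u Eu; rewrite subKr addrC; exact: L12q.
have LN L u : linear_on L -> E u -> L (- u) = - L u.
  by move=> [_ LZ] Eu; rewrite -scaleN1r LZ// mulN1r.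
have L1v : L1 v = q v.
  have := le_trans (L12 _ (submodN Ev)) (max_faceN sq Ev).
  rewrite !LN// => h; have := L1q v Ev; have := L2q v Ev => h2 h1.
  apply/eqP; rewrite eq_le h1/= leNgt; apply/negP => lt1.
  move/andP: a01 => [a0 a1].
  have : a * L1 v < a * q v by rewrite ltr_pM2l.
  have : (1 - a) * L2 v <= (1 - a) * q v by rewrite ler_pM2l// subr_gt0.
  by lra.
move=> u Eu; apply: lb_le_inf; first by exists (q (u + 0 *: v) - 0 * q v), 0 => /=.
move=> _ [s s0 <-]; have := L1q _ (ED Eu (EZ s Ev)).
by rewrite l1.1 ?l1.2//; [rewrite L1v; lra|exact: EZ].
Qed.

Lemma face_self : face p.
Proof. by split=> //; move=> ? ?. Qed.

(** A minimal face is a single linear functional, since it lies below each of its own subfaces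
    [max_face]; the face property then makes this functional extreme. *)
Lemma extreme_hahn_banach u0 : E u0 -> exists L, [/\ linear_on L, le_on L p, L u0 = p u0 &
  forall (a : R) L1 L2, 0 < a < 1 -> linear_on L1 -> linear_on L2 ->
    le_on L1 p -> le_on L2 p -> (forall u, E u -> a * L1 u + (1 - a) * L2 u = L u) ->
    forall u, E u -> L1 u = L u].
Proof.
move=> Eu0.
(* The bound at [- u0] survives infima and forces the value [p u0] at [u0] on the final linear
   functional. *)
pose T := {q : V -> R | face q /\ q (- u0) <= - p u0}.
pose t0 : T := exist _ (max_face p u0) (conj (face_max_face face_self Eu0) (max_faceN sp Eu0)).
(* The order is reversed: a maximal element for [ord] is a minimal functional. *)
pose ord : rel T := fun t t' => `[< le_on (sval t') (sval t) >].
have [t tmax] : exists t : T, premaximal (fun x y => ord x y) t.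
  apply: (ZL_preorder t0).
  - by move=> t; apply/asboolP => u _.
  - move=> t1 t2 t3 /asboolP h12 /asboolP h23; apply/asboolP => u Eu.
    exact: le_trans (h23 u Eu) (h12 u Eu).
  move=> A tA.
  have [->|/set0P[t1 At1]] := eqVneq A set0; first by exists t0.
  have dom (t : T) : [/\ sublinear_on (sval t), le_on (sval t) p & sval t (- u0) <= - p u0].
    by case: (svalP t) => -[].
  pose Q (t : T) := sval t.
  pose q u := inf [set Q t u | t in A].
  have lowb u (t : T) : E u -> - p (- u) <= Q t u.
    move=> Eu; have [st tp _] := dom t.
    have := sublinear_on_oppr_ge st (submodN Eu); rewrite opprK; apply: le_trans.
    by rewrite lerN2; exact: tp (submodN Eu).
  have leq (t : T) : A t -> le_on q (Q t).
    move=> At u Eu; apply: ge_inf; last by exists t.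
    by exists (- p (- u)) => _ [t' _ <-]; exact: lowb.
  have sq : sublinear_on q.
    apply: sublinear_on_inf; first by exists t1.
    - move=> t2 t3 u v A2 A3 Eu Ev.
      have [/asboolP h|/asboolP h] := tA _ _ A2 A3.
        exists t3 => //.
        by have [[D3 _] _ _] := dom t3; have := D3 _ _ Eu Ev; have := h u Eu; rewrite /Q; lra.
      exists t2 => //.
      by have [[D3 _] _ _] := dom t2; have := D3 _ _ Eu Ev; have := h v Ev; rewrite /Q; lra.
    - by move=> t2 c u A2 c0 Eu; exists t2 => //; have [[_ +] _ _] := dom t2; exact.
    - by move=> u Eu; exists (- p (- u)) => t' _; exact: lowb.
  have fq : face q.
    split => //.
      by move=> u Eu; have [_ + _] := dom t1 => /(_ u Eu); apply: le_trans (leq _ At1 u Eu).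
    move=> a L1 L2 a01 l1 l2 L1p L2p L12 u Eu.
    apply: lb_le_inf; first by exists (Q t1 u), t1.
    move=> _ [t' At' <-]; have [[_ _ F] _] := svalP t'.
    apply: (F a L1 L2) => // v Ev.
    exact: le_trans (L12 v Ev) (leq _ At' _ Ev).
  have qu0 : q (- u0) <= - p u0.
    by have [_ _] := dom t1; apply: le_trans (leq _ At1 _ (submodN Eu0)).
  by exists (exist _ q (conj fq qu0)) => t' At'; apply/asboolP => u Eu /=; exact: leq.
pose L := sval t.
have [[sL Lp FL] Lu0] := svalP t; rewrite -/L in sL Lp FL Lu0.
(* Minimality gives [L <= max_face L v], and the right-hand side is at most [- L v] at [- v].
   Oddness together with sublinearity is linearity. *)
have LN v : E v -> L (- v) = - L v.
  move=> Ev; apply/eqP; rewrite eq_le sublinear_on_oppr_ge// andbT.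
  have fm := face_max_face (And3 sL Lp FL) Ev.
  have mu0 : max_face L v (- u0) <= - p u0.
    exact: le_trans (max_face_le sL Ev (submodN Eu0)) Lu0.
  pose t' : T := exist _ (max_face L v) (conj fm mu0).
  have tt' : ord t t' by apply/asboolP => u Eu; exact: max_face_le.
  have /asboolP /(_ _ (submodN Ev)) /= h := tmax t' tt'; exact: le_trans h (max_faceN sL Ev).
have LD u v : E u -> E v -> L (u + v) = L u + L v.
  move=> Eu Ev; apply/eqP; rewrite eq_le sL.1//=.
  have := sL.1 _ _ (ED Eu Ev) (submodN Ev); rewrite addrK LN//; lra.
have linL : linear_on L.
  split=> // c u Eu; have [c0|c0] := leP 0 c; first exact: sublinear_onZ.
  rewrite -[c]opprK scaleNr LN; last exact: EZ.
  by rewrite sublinear_onZ// ?mulNr// oppr_ge0 ltW.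
exists L; split => //.
  apply/eqP; rewrite eq_le Lp//=.
  by move: Lu0; rewrite LN// lerN2.
move=> a L1 L2 a01 l1 l2 L1p L2p L12 u Eu.
have L1L : le_on L1 L by apply: (FL a L1 L2) => // v Ev; rewrite L12.
apply/eqP; rewrite eq_le L1L//=.
have := L1L _ (submodN Eu); rewrite LN//.
by rewrite -scaleN1r l1.2// mulN1r lerN2.
Qed.

End ExtremeHahnBanach.

(** * The Daniell outer measure *)

Section DaniellOuterMeasure.
Variables (R : realType) (T : topologicalType).
Hypothesis compactT : compact [set: T].
Variable L : (T -> R) -> R.
Local Notation C := [set f : T -> R | continuous f].
Hypotheses (linL : linear_on C L)
  (L_ge0 : forall f : T -> R, continuous f -> (forall x, 0 <= f x) -> 0 <= L f).
Hypothesis L1 : L (fun=> 1) = 1.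
Implicit Types (f g : T -> R) (A E : set T).

Let LD f g : continuous f -> continuous g -> L (fun x => f x + g x) = L f + L g.
Proof. by move=> cf cg; exact: linL.1. Qed.

Let LZ c f : continuous f -> L (fun x => c * f x) = c * L f.
Proof. by move=> cf; exact: (linL.2 c f). Qed.

Let LB f g : continuous f -> continuous g -> L (fun x => f x - g x) = L f - L g.
Proof.
move=> cf cg; rewrite -mulN1r -LZ// -LD//; last exact: continuousZ_fun.
by congr L; apply/funext => x; rewrite mulN1r.
Qed.

Let L_le f g : continuous f -> continuous g -> (forall x, f x <= g x) -> L f <= L g.
Proof.
move=> cf cg fg; rewrite -subr_ge0 -LB//; apply: L_ge0; first exact: continuousB_fun.
by move=> x; rewrite subr_ge0.
Qed.

Let L_cst c : L (fun=> c) = c.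
Proof.
transitivity (L (fun=> c * 1)); first by congr L; apply/funext => x; rewrite mulr1.
by rewrite LZ ?L1 ?mulr1//; exact: continuous_cst_fun.
Qed.

Let L_sum (n : nat) (F : nat -> T -> R) : (forall i, continuous (F i)) ->
  L (fun x => \sum_(i < n) F i x) = \sum_(i < n) L (F i).
Proof.
move=> cF; elim: n => [|n IH].
  by rewrite big_ord0 -[RHS](L_cst 0); congr L; apply/funext => x; rewrite big_ord0.
rewrite big_ord_recr /= -IH -LD//; last exact: continuous_sum_fun.
by congr L; apply/funext => x; rewrite big_ord_recr.
Qed.

(* Covers are increasing sequences rather than series, so that countable unions
   are covered by partial sums along a diagonal. *)
Definition upper_cover A (c : R) (phi : nat -> T -> R) :=
  [/\ forall n, continuous (phi n), forall n x, 0 <= phi n x,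
      forall x m n, (m <= n)%N -> phi m x <= phi n x, forall n, L (phi n) <= c &
      forall x, A x -> exists n, 1 <= phi n x].

Definition mstar A : R := inf [set c | exists phi, upper_cover A c phi].

Let cover_ge0 A c phi : upper_cover A c phi -> 0 <= c.
Proof. by move=> [cp p0 _ Lc _]; apply: le_trans (Lc 0%N); exact: L_ge0. Qed.

Lemma upper_cover_cst A f : continuous f -> (forall x, 0 <= f x) ->
  (forall x, A x -> 1 <= f x) -> upper_cover A (L f) (fun=> f).
Proof. by move=> cf f0 f1; split => // x Ax; exists 0%N; exact: f1. Qed.

Lemma mstar_has_inf A : has_inf [set c | exists phi, upper_cover A c phi].
Proof.
split; last by exists 0 => c [phi /cover_ge0].
exists (L (fun=> 1)), (fun _ _ => 1); apply: upper_cover_cst => //.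
exact: continuous_cst_fun.
Qed.

Lemma mstar_le A c phi : upper_cover A c phi -> mstar A <= c.
Proof. by move=> cov; apply: ge_inf; [exact: (mstar_has_inf A).2|exists phi]. Qed.

Lemma mstar_le_L A f : continuous f -> (forall x, 0 <= f x) ->
  (forall x, A x -> 1 <= f x) -> mstar A <= L f.
Proof. by move=> cf f0 f1; apply: mstar_le (upper_cover_cst cf f0 f1). Qed.

Lemma mstar_ge A c : (forall c' phi, upper_cover A c' phi -> c <= c') -> c <= mstar A.
Proof.
by move=> h; apply: lb_le_inf; [exact: (mstar_has_inf A).1|move=> c' [phi /h]].
Qed.

Lemma mstar_approx A e : 0 < e -> exists c phi, upper_cover A c phi /\ c < mstar A + e.
Proof.
by move=> e0; have [c [phi cov] ce] := inf_adherent e0 (mstar_has_inf A); exists c, phi.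
Qed.

Lemma mstar_ge0 A : 0 <= mstar A.
Proof. by apply: mstar_ge => c phi /cover_ge0. Qed.

Lemma mstar0 : mstar set0 = 0.
Proof.
apply/eqP; rewrite eq_le mstar_ge0 andbT -[leRHS](L_cst 0).
by apply: mstar_le_L => //; exact: continuous_cst_fun.
Qed.

Lemma le_mstar A E : A `<=` E -> mstar A <= mstar E.
Proof.
move=> AE; apply: mstar_ge => c phi [cp p0 pm Lc Ec].
by apply: (@mstar_le _ _ phi); split => // x /AE /Ec.
Qed.

(** The lower bound is Dini's argument. If every [phi n] dropped below [1 - e] at some [z n], then
    near a cluster point [x] of these points some [phi n] would exceed [1 - e], while
    [phi n (z m) <= phi m (z m) < 1 - e] for all later m. *)
Lemma mstarT : mstar setT = 1.
Proof.
apply/eqP; rewrite eq_le; apply/andP; split.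
  by rewrite -[leRHS]L1; apply: mstar_le_L => //; exact: continuous_cst_fun.
apply: mstar_ge => c phi [cp p0 pm Lc Ec].
apply/ler_addgt0Pr => e e0; rewrite -lerBlDr.
suff [n nP] : exists n, forall x, 1 - e <= phi n x.
  by apply: le_trans (Lc n); rewrite -[leLHS]L_cst; apply: L_le => //; exact: continuous_cst_fun.
apply: contrapT => noN.
have /choice[z zP] : forall n, exists x, phi n x < 1 - e.
  move=> n; apply: contrapT => h; apply: noN; exists n => x; rewrite leNgt; apply/negP => hx.
  by apply: h; exists x.
have [x [_ xcl]] := compactT (fmap_proper_filter z eventually_filter) filterT.
have [n n1] := Ec x I.
have nU : nbhs x [set y | 1 - e < phi n y].
  apply: open_nbhs_nbhs; split; last by rewrite /=; lra.
  rewrite (_ : [set _ | _] = [set y | 0 < phi n y - (1 - e)]).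
    by apply: open_gt0; apply: continuousB_fun => //; exact: continuous_cst_fun.
  by apply/seteqP; split => y /=; rewrite subr_gt0.
have zn : (z @ \oo) [set y | phi n y < 1 - e].
  exists n => // m /= nm; apply: le_lt_trans (zP m).
  exact: pm.
by have [y [/= h1 h2]] := xcl _ _ zn nU; have := lt_trans h1 h2; rewrite ltxx.
Qed.

Let nu A : \bar R := (mstar A)%:E.

Let nu0 : nu set0 = 0%E. Proof. by rewrite /nu mstar0. Qed.

Let nu_ge0 A : (0 <= nu A)%E. Proof. by rewrite lee_fin mstar_ge0. Qed.

Let le_nu : {homo nu : A E / A `<=` E >-> (A <= E)%E}.
Proof. by move=> A E AE; rewrite lee_fin le_mstar. Qed.

Let nu_subadd : sigma_subadditive nu.
Proof.
move=> F.
have [->|] := eqVneq (\sum_(i <oo) nu (F i))%E +oo%E; first by rewrite leey.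
move=> sfin.
have s0 : (0 <= \sum_(i <oo) nu (F i))%E by exact: nneseries_ge0.
have [s sE] : exists s : R, (\sum_(i <oo) nu (F i))%E = s%:E.
  by move: s0 sfin; case: (\sum_(i <oo) nu (F i))%E => // s _ _; exists s.
rewrite sE lee_fin; apply/ler_addgt0Pr => e e0.
have part n : \sum_(i < n) mstar (F i) <= s.
  rewrite -lee_fin -sE -sumEFin -(big_mkord xpredT (fun i => nu (F i))).
  exact: nneseries_lim_ge.
have d0 (k : nat) : 0 < e / 2 ^+ k.+1 by rewrite divr_gt0// exprn_gt0.
have /choice[c /choice[phi cphi]] := fun k => mstar_approx (F k) (d0 k).
apply: (@mstar_le _ _ (fun n x => \sum_(k < n) phi k n x)); split.
- by move=> n; apply: continuous_sum_fun => i; have [[]] := cphi i.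
- by move=> n x; apply: sumr_ge0 => i _; have [[]] := cphi i.
- move=> x m n mn; rewrite -(subnKC mn) big_split_ord /=.
  rewrite -[leLHS]addr0; apply: lerD.
    by apply: ler_sum => i _; have [[_ _ h _ _] _] := cphi i; apply: h; rewrite leq_addr.
  by apply: sumr_ge0 => i _; have [[]] := cphi (m + i)%N.
- move=> n; rewrite (@L_sum n (fun k => phi k n)); last by move=> i; have [[]] := cphi i.
  apply: (@le_trans _ _ (\sum_(k < n) (mstar (F k) + e / 2 ^+ k.+1))).
    apply: ler_sum => i _; have [[_ _ _ h _] ce] := cphi i.
    exact: le_trans (h n) (ltW ce).
  rewrite big_split /=; apply: lerD; first exact: part.
  rewrite [leLHS](_ : _ = e * (1 - 2^-1 ^+ n)); last first.
    elim: n => [|n IH]; first by rewrite big_ord0 expr0 subrr mulr0.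
    rewrite big_ord_recr /= IH -exprVn exprS.
    by set z := 2^-1 ^+ n; field.
  by rewrite ler_piMr// ?(ltW e0)// gerBl exprn_ge0.
- move=> x [k _ Fkx]; have [[_ p0 h _ cov] _] := cphi k; have [m m1] := cov x Fkx.
  (* The index must reach stage [m] of the k-th cover and exceed [k], so that the k-th summand is
     present. *)
  exists (maxn m k.+1).
  have kn : (k < maxn m k.+1)%N by rewrite leq_max leqnn orbT.
  rewrite (bigD1 (Ordinal kn))//= -[1]addr0; apply: lerD.
    by apply: le_trans m1 _; apply: h; rewrite leq_max leqnn.
  by apply: sumr_ge0 => i _; have [[]] := cphi i.
Qed.

HB.instance Definition _ := isOuterMeasure.Build R T nu nu0 nu_ge0 le_nu nu_subadd.

Definition daniell : {outer_measure set T -> \bar R} := nu.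

Lemma daniellE A : daniell A = (mstar A)%:E. Proof. by []. Qed.

(** The functions [v k] increase to the indicator of [A]. A cover [psi] of [E] splits into
    [psi n * v n], which covers the part in [A], and [psi n * (1 - v m)], which covers the rest.
    Freezing [m] keeps the second sequence increasing; choosing [m] with [L (f m)] within [e] of its
    supremum makes the total cost at most [c + e]. *)
Lemma caratheodory_gt0 (u : T -> R) : continuous u -> (forall x, 0 <= u x) ->
  daniell.-caratheodory [set x | 0 < u x].
Proof.
move=> cu u0; apply: le_caratheodory_measurable => E.
rewrite !daniellE -EFinD lee_fin; set A := [set x | _].
apply: mstar_ge => c psi [cp p0 pm Lc Ec].
apply/ler_addgt0Pr => e e0.
pose v (k : nat) x := Num.min 1 (k%:R * u x).
have cv k : continuous (v k).
  by apply: continuous_min_fun; [exact: continuous_cst_fun|exact: continuousZ_fun].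
have v0 k x : 0 <= v k x by rewrite le_min ler01 mulr_ge0.
have v1 k x : v k x <= 1 by rewrite ge_min lexx.
have vm x m n : (m <= n)%N -> v m x <= v n x.
  move=> mn; rewrite le_min v1/= ge_min; apply/orP; right.
  by rewrite ler_wpM2r// ler_nat.
pose f n x := psi n x * v n x.
have cf n : continuous (f n) by apply: continuousM_fun.
have f0 n x : 0 <= f n x by rewrite mulr_ge0.
have fm x m n : (m <= n)%N -> f m x <= f n x.
  by move=> mn; apply: ler_pM => //; [exact: pm|exact: vm].
pose S := [set L (f n) | n in setT].
have hS : has_sup S.
  split; first by exists (L (f 0%N)), 0%N.
  exists c => _ [n _ <-]; apply: le_trans (Lc n); apply: L_le => // x.
  by rewrite ler_piMr.
have [_ [m _ <-] mS] := sup_adherent e0 hS.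
have cov1 : upper_cover (E `&` A) (sup S) f.
  split => //; first by move=> n; apply: ub_le_sup; [exact: hS.2|exists n].
  move=> x [/Ec[n n1] Ax].
  pose k := maxn n (Num.bound (u x)^-1).
  exists k; rewrite /f (_ : v k x = 1).
    by rewrite mulr1; apply: le_trans n1 (pm _ _ _ _); rewrite leq_max leqnn.
  rewrite /v min_l// -ler_pdivrMr// div1r.
  have uV : 0 <= (u x)^-1 by rewrite invr_ge0.
  rewrite (le_trans (ltW (archi_boundP uV)))// ler_nat leq_max leqnn orbT//.
have cov2 : upper_cover (E `&` ~` A) (c - L (f m)) (fun n x => psi n x * (1 - v m x)).
  split.
  - move=> n; apply: continuousM_fun => //; apply: continuousB_fun => //.
    exact: continuous_cst_fun.
  - by move=> n x; rewrite mulr_ge0// subr_ge0.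
  - by move=> x k n kn; rewrite ler_wpM2r ?subr_ge0//; exact: pm.
  - move=> n; pose N := maxn n m.
    have cN : continuous (fun x => psi N x * v m x) by exact: continuousM_fun.
    apply: (@le_trans _ _ (L (fun x => psi N x - psi N x * v m x))).
      apply: L_le; [|exact: continuousB_fun|].
        apply: continuousM_fun => //; apply: continuousB_fun => //.
        exact: continuous_cst_fun.
      move=> x; rewrite -[X in _ <= X - _]mulr1 -mulrBr ler_wpM2r ?subr_ge0//.
      by apply: pm; rewrite leq_max leqnn.
    rewrite LB//; apply: lerB; first exact: Lc.
    apply: L_le => // x; rewrite ler_wpM2r//.
    by apply: pm; rewrite leq_max leqnn orbT.
  - move=> x [/Ec[n n1] Ax]; exists n.
    have -> : v m x = 0.
      have ux : u x = 0 by apply/eqP; rewrite eq_le u0 andbT leNgt; apply/negP.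
      by rewrite /v ux mulr0 min_r.
    by rewrite subr0 mulr1.
have := mstar_le cov1; have := mstar_le cov2; lra.
Qed.

(** The multiples of [u] by integers eventually exceed 1 wherever [u] is positive, and all of them
    have cost at most 0. *)
Lemma mstar_null_gt0 (u : T -> R) : continuous u -> (forall x, 0 <= u x) -> L u <= 0 ->
  mstar [set x | 0 < u x] = 0.
Proof.
move=> cu u0 Lu; apply/eqP; rewrite eq_le mstar_ge0 andbT.
apply: (@mstar_le _ _ (fun n x => n%:R * u x)); split.
- by move=> n; exact: continuousZ_fun.
- by move=> n x; rewrite mulr_ge0.
- by move=> x m n mn; rewrite ler_wpM2r// ler_nat.
- by move=> n; rewrite LZ// mulr_ge0_le0.
- move=> x /= ux; exists (Num.bound (u x)^-1); rewrite -ler_pdivrMr// div1r.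
  by apply/ltW/archi_boundP; rewrite invr_ge0.
Qed.

Lemma mstar_preimage_le (S : T -> T) A : continuous S ->
  (forall f, continuous f -> L (f \o S) = L f) -> mstar (S @^-1` A) <= mstar A.
Proof.
move=> cS LS; apply: mstar_ge => c phi [cp p0 pm Lc Ec].
apply: (@mstar_le _ _ (fun n => phi n \o S)); split.
- by move=> n x; apply: continuous_comp; [exact: cS|exact: cp].
- by move=> n x; exact: p0.
- by move=> x m n mn; exact: pm.
- by move=> n; rewrite LS.
- by move=> x /Ec.
Qed.

End DaniellOuterMeasure.

(** * The measure of a positive functional *)

Section ContinuousIntegrable.
Variables (R : realType) (d : nat).
Local Notation Sd := (Defs.Sd R d).
Local Notation SdB := (Defs.SdB R d).
Implicit Type f : Sd -> R.

Lemma wopen_measurable (U : set SdB) : open (U : set Sd) -> measurable U.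
Proof. by move=> oU; apply: sub_sigma_algebra. Qed.

Lemma continuous_measurable_Sd f : continuous f -> measurable_fun setT (f : SdB -> R).
Proof.
move=> cf; apply: (measurability _ (RGenInftyO.measurableE R)) => _ [_ [r ->] <-].
rewrite setTI; apply: wopen_measurable.
rewrite (_ : _ @^-1` _ = [set h | 0 < r - f h]).
  by apply: open_gt0; apply: continuousB_fun => //; exact: continuous_cst_fun.
by apply/seteqP; split => h /=; rewrite in_itv/= subr_gt0.
Qed.

Lemma continuous_bounded_Sd f : continuous f -> exists M, forall h, `|f h| <= M.
Proof.
move=> cf.
have T0 : [set: Sd] !=set0 by exists point.
have cNf : continuous (fun h => - f h) by exact: continuousN_fun.
have [a _ aM] := compact_EVT_max T0 (@Sd_compact R d) (continuous_subspaceT cf).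
have [b _ bM] := compact_EVT_max T0 (@Sd_compact R d) (continuous_subspaceT cNf).
exists (Num.max (f a) (- f b)) => h; rewrite ler_norml lerNl !le_max.
by rewrite aM ?inE// bM ?inE// orbT.
Qed.

Lemma continuous_integrable_Sd (mu : probability SdB R) f (A : set SdB) : continuous f ->
  measurable A -> mu.-integrable A (EFin \o f).
Proof.
move=> cf mA; apply: measurable_bounded_integrable => //.
- by rewrite ltey_eq fin_num_measure.
- exact: (measurable_funTS (continuous_measurable_Sd cf)).
- have [M MP] := continuous_bounded_Sd cf.
  by exists M; split; [exact: num_real|move=> x Mx h _ /=; rewrite (le_trans (MP h))// ltW].
Qed.

End ContinuousIntegrable.

Section DaniellMeasure.
Variables (R : realType) (d : nat).
Local Notation Sd := (Defs.Sd R d).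
Local Notation SdB := (Defs.SdB R d).
Local Notation C := [set f : Sd -> R | continuous f].
Variable L : (Sd -> R) -> R.
Hypotheses (linL : linear_on C L)
  (L_ge0 : forall f : Sd -> R, continuous f -> (forall x, 0 <= f x) -> 0 <= L f).
Hypothesis L1 : L (fun=> 1) = 1.

Local Notation outer := (daniell linL L_ge0 L1).

Let measurable_caratheodory (A : set SdB) : measurable A -> outer.-caratheodory A.
Proof.
move: A; apply: smallest_sub; first exact: (sigma_algebra_measurable (caratheodory_type outer)).
move=> U oU.
(* Only base sets contained in [U] are kept, the others being replaced by the empty set, so that [U]
   becomes a countable union of cozero sets. *)
pose F n := if pselect (forall h, 0 < @base_bump R d n h -> U h) is left _
  then [set h | 0 < @base_bump R d n h] else set0.
have -> : U = \bigcup_n F n.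
  apply/seteqP; split => [h Uh|h [n _]].
    have [n [n0 nU]] := base_bumpP oU Uh.
    by exists n => //; rewrite /F; case: pselect.
  by rewrite /F; case: pselect => // nU /nU.
apply: caratheodory_measurable_bigcup => n; rewrite /F; case: pselect => _.
  by apply: caratheodory_gt0; [exact: base_bump_continuous|exact: base_bump_ge0].
exact: caratheodory_measurable_set0.
Qed.

Let m (A : set SdB) : \bar R := (mstar L A)%:E.

Let m0 : m set0 = 0%E.
Proof. exact: (outer_measure0 outer). Qed.

Let m_ge0 A : (0 <= m A)%E.
Proof. exact: (outer_measure_ge0 outer). Qed.

Let m_additive : semi_sigma_additive m.
Proof.
move=> F mF tF mUF.
apply: (@caratheodory_measure_sigma_additive R Sd outer) => //.
- by move=> i; exact: measurable_caratheodory.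
- exact: measurable_caratheodory.
Qed.

HB.instance Definition _ := isMeasure.Build _ _ _ m m0 m_ge0 m_additive.

Let mT : m setT = 1%E.
Proof. by rewrite /m (mstarT (@Sd_compact R d) linL L_ge0 L1). Qed.

HB.instance Definition _ := Measure_isProbability.Build _ _ _ m mT.

Lemma daniell_probability : exists mu : probability SdB R, forall A, mu A = (mstar L A)%:E.
Proof. by exists m. Qed.

Variable mu : probability SdB R.
Hypothesis muE : forall A, mu A = (mstar L A)%:E.

Let I (f : Sd -> R) := \int[mu]_h f h.

Let ID (f g : Sd -> R) : continuous f -> continuous g -> I (fun h => f h + g h) = I f + I g.
Proof.
by move=> cf cg; rewrite /I RintegralD//; exact: continuous_integrable_Sd.
Qed.

Let LD (f g : Sd -> R) : continuous f -> continuous g -> L (fun x => f x + g x) = L f + L g.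
Proof. by move=> cf cg; exact: linL.1. Qed.

Let LZ c (f : Sd -> R) : continuous f -> L (fun x => c * f x) = c * L f.
Proof. by move=> cf; exact: (linL.2 c f). Qed.

(** Peel off slices of height [e]. The slice [chi] has integral at most [e] times the mass of
    [f > 0], while [L chi] is at least [e] times the mass of [f > e]. The latter pays for the error
    of the remaining function [psi], so the errors telescope and the final one does not depend on
    [N]. *)
Let I_le_layer (e : R) N (f : Sd -> R) : 0 < e -> continuous f ->
  (forall h, 0 <= f h <= N%:R * e) -> I f <= L f + e * mstar L [set h | 0 < f h].
Proof.
move=> e0; elim: N f => [|N IH] f cf fN.
  have f0 h : f h = 0.
    by apply/eqP; rewrite eq_le andbC; have := fN h; rewrite mul0r.
  rewrite /I (_ : \int[mu]_h f h = 0).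
    rewrite addr_ge0//; first by apply: L_ge0 => // h; rewrite f0.
    by apply: mulr_ge0; [exact: ltW|exact: mstar_ge0].
  by under eq_Rintegral do rewrite f0; rewrite Rintegral_cst// mul0r.
pose psi h := Num.max (f h - e) 0; pose chi h := Num.min (f h) e.
have cpsi : continuous psi.
  apply: continuous_max_fun; last exact: continuous_cst_fun.
  by apply: continuousB_fun => //; exact: continuous_cst_fun.
have cchi : continuous chi by apply: continuous_min_fun => //; exact: continuous_cst_fun.
have fE : f = (fun h => psi h + chi h).
  apply/funext => h; rewrite /psi /chi.
  by case: (leP (f h) e) => fe; case: (leP (f h - e) 0) => fe'; lra.
have psiN h : 0 <= psi h <= N%:R * e.
  rewrite le_max lexx orbT/= ge_max; have /andP[_] := fN h.
  rewrite -natr1 mulrDl mul1r => h1; apply/andP; split; first lra.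
  by rewrite mulr_ge0// ltW.
have Ichi : I chi <= e * mstar L [set h | 0 < f h].
  have mf : measurable ([set h | 0 < f h] : set SdB) by apply: wopen_measurable; exact: open_gt0.
  pose A : set SdB := [set h | 0 < f h].
  have i1 : mu.-integrable setT (EFin \o \1_A) by exact: integrable_indic.
  have -> : e * mstar L [set h | 0 < f h] = \int[mu]_h (e * \1_A h).
    rewrite RintegralZl//; congr (_ * _).
    rewrite /Rintegral integral_indic//.
    by rewrite setIT -[LHS]/(fine (mstar L A)%:E) -(muE A).
  apply: le_Rintegral => //.
  - exact: continuous_integrable_Sd.
  - exact: (integrableZl measurableT e i1).
  - move=> h _; rewrite indicE; case: (boolP (h \in A)) => [_|].
      by rewrite mulr1 ge_min lexx orbT.
    rewrite notin_setE /A /= => /negP; rewrite -leNgt => h0.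
    by rewrite mulr0 ge_min h0.
have Lchi : e * mstar L [set h | 0 < psi h] <= L chi.
  rewrite -ler_pdivlMl// -LZ//; apply: (mstar_le_L L_ge0).
  - exact: continuousZ_fun.
  - move=> h; rewrite mulr_ge0 ?invr_ge0 ?(ltW e0)// le_min (ltW e0) andbT.
    by have /andP[] := fN h.
  - move=> h /=; rewrite lt_max ltxx orbF subr_gt0 => efh.
    by rewrite /chi min_r ?(ltW efh)// mulVf// gt_eqF.
rewrite [in leLHS]fE ID// [in L f]fE LD//.
by have := IH psi cpsi psiN; lra.
Qed.

(** As [e] tends to 0, [I_le_layer] yields one inequality for nonnegative functions. Applied to
    [M + f] and to [M - f], with [M] a bound of [|f|], it gives both inequalities for [f]. *)
Lemma Rintegral_daniell (f : Sd -> R) : continuous f -> \int[mu]_h f h = L f.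
Proof.
have le1 A : mstar L A <= 1.
  by rewrite -(mstarT (@Sd_compact R d) linL L_ge0 L1); exact: (le_mstar L_ge0).
have Lc c : L (fun=> c) = c.
  transitivity (L (fun=> c * 1)); first by congr L; apply/funext => x; rewrite mulr1.
  by rewrite LZ ?L1 ?mulr1//; exact: continuous_cst_fun.
have Ic c : I (fun=> c) = c.
  rewrite /I Rintegral_cst// -[RHS]mulr1; congr (_ * _).
  by rewrite [X in fine X](@probability_setT _ _ _ mu).
have le_IL (g : Sd -> R) : continuous g -> (forall h, 0 <= g h) -> I g <= L g.
  move=> cg g0; apply/ler_addgt0Pr => e e0.
  have [M MP] := continuous_bounded_Sd cg.
  have M0 : 0 <= M by apply: le_trans (MP point).
  have Me : 0 <= M / e by rewrite divr_ge0// ltW.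
  have gN h : 0 <= g h <= (Num.bound (M / e))%:R * e.
    rewrite g0/= -ler_pdivrMr// (le_trans _ (ltW (archi_boundP Me)))//.
    by rewrite ler_pM2r ?invr_gt0//; apply: le_trans (MP h); exact: ler_norm.
  apply: (le_trans (I_le_layer e0 cg gN)); rewrite lerD2l.
  by rewrite ler_piMr// ltW.
move=> cf; have [M MP] := continuous_bounded_Sd cf.
have cM : continuous (fun _ : Sd => M) by exact: continuous_cst_fun.
have cN : continuous (fun h => -1 * f h) by exact: continuousZ_fun.
have cNM := continuousD_fun cM cN.
have cMf := continuousD_fun cM cf.
have IN : I (fun h => -1 * f h) = - I f.
  by rewrite /I RintegralZl ?mulN1r//; exact: continuous_integrable_Sd.
have h1 : I (fun h => M + f h) <= L (fun h => M + f h).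
  by apply: le_IL => // h; have := MP h; rewrite ler_norml; lra.
have h2 : I (fun h => M + -1 * f h) <= L (fun h => M + -1 * f h).
  by apply: le_IL => // h; have := MP h; rewrite ler_norml; lra.
move: h1 h2; rewrite !ID// !LD// IN LZ// Lc Ic => h1 h2.
by rewrite -/(I f); lra.
Qed.

End DaniellMeasure.

(** * Translations and upper means *)

Section Shift.
Variables (R : realType) (d : nat).
Local Notation Sd := (Defs.Sd R d).
Implicit Types (v w x : d.-tuple R) (h : Sd) (phi psi : Sd -> R).

Definition tzero : d.-tuple R := [tuple 0 | i < d].
Definition topp v : d.-tuple R := [tuple - tnth v i | i < d].

Lemma taddC v w : tadd v w = tadd w v.
Proof. by apply: eq_from_tnth => i; rewrite !tnth_mktuple addrC. Qed.

Lemma taddA x v w : tadd x (tadd v w) = tadd (tadd x v) w.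
Proof. by apply: eq_from_tnth => i; rewrite !tnth_mktuple addrA. Qed.

Lemma tadd0 v : tadd v tzero = v.
Proof. by apply: eq_from_tnth => i; rewrite !tnth_mktuple addr0. Qed.

Lemma taddN v : tadd v (topp v) = tzero.
Proof. by apply: eq_from_tnth => i; rewrite !tnth_mktuple subrr. Qed.

Lemma taddK v w : tadd (tadd v w) (topp w) = v.
Proof. by rewrite -taddA taddN tadd0. Qed.

Lemma Sd_eq h1 h2 : (forall x, Defs.sfun h1 x = Defs.sfun h2 x) -> h1 = h2.
Proof.
case: h1 h2 => [f1 m1 p1 q1] [f2 m2 p2 q2] /= /funext E; case: _ / E in m2 p2 q2 *.
by rewrite (Prop_irrelevance m1 m2) (Prop_irrelevance p1 p2) (Prop_irrelevance q1 q2).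
Qed.

Lemma Tshift_comp v w h : Tshift v (Tshift w h) = Tshift (tadd v w) h.
Proof. by apply: Sd_eq => x /=; rewrite taddA. Qed.

Lemma Tshift0 h : Tshift tzero h = h.
Proof. by apply: Sd_eq => x /=; rewrite tadd0. Qed.

Lemma TshiftK v : cancel (@Tshift R d v) (Tshift (topp v)).
Proof. by move=> h; rewrite Tshift_comp taddC taddN Tshift0. Qed.

Lemma TshiftNK v : cancel (@Tshift R d (topp v)) (Tshift v).
Proof. by move=> h; rewrite Tshift_comp taddN Tshift0. Qed.

Lemma Tshift_image v (A : set Sd) : Tshift v @` A = Tshift (topp v) @^-1` A.
Proof.
apply/seteqP; split => [_ [h Ah <-] /=|h /= Ah]; first by rewrite TshiftK.
by exists (Tshift (topp v) h) => //; rewrite TshiftNK.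
Qed.

Lemma iint_shift v h (g : d.-tuple R -> R) :
  measurable_fun setT g -> (forall x, 0 <= g x) ->
  iint (fun x => (Defs.sfun (Tshift v h) x * g x)%:E) =
  iint (fun x => (Defs.sfun h x * g (tadd x (topp v)))%:E).
Proof.
move=> mg g0.
rewrite -(@iint_tadd R d v (fun x => (Defs.sfun h x * g (tadd x (topp v)))%:E)).
- by apply: eq_iint => x /=; rewrite taddK.
- apply/measurable_EFinP; apply: measurable_funM; first exact: sfun_meas.
  exact: (measurableT_comp mg (measurable_tadd _)).
- by move=> x; rewrite lee_fin mulr_ge0// sfun_ge0.
Qed.

Lemma integrable_Rd_shift v g : integrable_Rd g -> integrable_Rd (fun x => g (tadd x v)).
Proof.
move=> [mg ig]; split; first exact: (measurableT_comp mg (measurable_tadd _)).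
rewrite (@iint_tadd R d v (fun x => `|g x|%:E))//.
by apply/measurable_EFinP; exact: measurableT_comp.
Qed.

Lemma pairing_Tshift v h g : integrable_Rd g ->
  pairing (Tshift v h) g = pairing h (fun x => g (tadd x (topp v))).
Proof.
move=> [mg _]; rewrite /pairing; congr (fine _ - fine _).
- rewrite (@iint_shift v h (fun x => Num.max (g x) 0))//.
    exact: measurable_maxr.
  by move=> x; rewrite le_max lexx orbT.
- rewrite (@iint_shift v h (fun x => Num.max (- g x) 0))//.
    by apply: measurable_maxr => //; exact: measurableT_comp.
  by move=> x; rewrite le_max lexx orbT.
Qed.

Lemma Tshift_continuous v : continuous (@Tshift R d v).
Proof.
apply/continuousP => U oU; have oU' : Defs.wopen U by [].
suff : Defs.wopen (Tshift v @^-1` U) by [].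
move=> h /= Uh; have [n [g [e [e0 [ig H]]]]] := oU' _ Uh.
exists n, (fun i x => g i (tadd x (topp v))), e; split => //; split.
  by move=> i; exact: integrable_Rd_shift.
by move=> h' h'e /=; apply: H => i; rewrite !pairing_Tshift.
Qed.

Lemma continuous_Tshift_comp v (f : Sd -> R) : continuous f -> continuous (fun h => f (Tshift v h)).
Proof. by move=> cf h; apply: continuous_comp; [exact: Tshift_continuous|exact: cf]. Qed.

(** A list counts repeated translations with multiplicity, so that averaging over all sums of two
    lists is exactly the composition of the two means. *)
Definition avg (s : seq (d.-tuple R)) (phi : Sd -> R) h : R :=
  (size s)%:R^-1 * \sum_(v <- s) phi (Tshift v h).

Lemma avg_continuous s phi : continuous phi -> continuous (avg s phi).
Proof.
move=> cphi; apply: continuousZ_fun; apply: continuous_sum_fun => v.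
exact: continuous_Tshift_comp.
Qed.

Lemma avgD s phi psi h : avg s (fun h => phi h + psi h) h = avg s phi h + avg s psi h.
Proof. by rewrite /avg big_split mulrDr. Qed.

Lemma avgZ s c phi h : avg s (fun h => c * phi h) h = c * avg s phi h.
Proof. by rewrite /avg -mulr_sumr mulrCA. Qed.

Lemma avg_comp s t phi h :
  avg [seq tadd v w | v <- s, w <- t] phi h = avg t (avg s phi) h.
Proof.
rewrite /avg size_allpairs natrM invfM [_^-1 * _^-1]mulrC -mulrA; congr (_ * _).
rewrite big_allpairs_dep exchange_big /= mulr_sumr; apply: eq_bigr => w _; congr (_ * _).
by apply: eq_bigr => v _; rewrite Tshift_comp.
Qed.

(** Since translations commute, either list may be taken as the inner one. Subadditivity of
    [upper_mean] uses one order for each summand. *)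
Lemma avg_compC s t phi h :
  avg [seq tadd v w | v <- s, w <- t] phi h = avg s (avg t phi) h.
Proof.
rewrite /avg size_allpairs natrM invfM -mulrA; congr (_ * _).
rewrite big_allpairs_dep /= mulr_sumr; apply: eq_bigr => v _; congr (_ * _).
by apply: eq_bigr => w _; rewrite Tshift_comp taddC.
Qed.

Lemma avg_le s phi h c : s != [::] -> (forall v, phi (Tshift v h) <= c) -> avg s phi h <= c.
Proof.
move=> s0 le_c; have n0 : 0 < (size s)%:R :> R by rewrite ltr0n lt0n size_eq0.
rewrite /avg ler_pdivrMl//; elim: s {s0 n0} => [|v s IH]; first by rewrite big_nil mul0r.
by rewrite big_cons /= -natr1 mulrDl mul1r addrC lerD.
Qed.

Variable f : Sd.

Definition sup_orbit (phi : Sd -> R) : R := sup [set phi (Tshift u f) | u in setT].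

Lemma sup_orbit_has_sup phi : continuous phi -> has_sup [set phi (Tshift u f) | u in setT].
Proof.
move=> cphi; split; first by exists (phi (Tshift tzero f)), tzero.
have [M MP] := continuous_bounded_Sd cphi.
by exists M => _ [u _ <-]; apply: le_trans (MP _); exact: ler_norm.
Qed.

Lemma le_sup_orbit phi u : continuous phi -> phi (Tshift u f) <= sup_orbit phi.
Proof. by move=> cphi; apply: ub_le_sup; [exact: (sup_orbit_has_sup cphi).2|exists u]. Qed.

Lemma sup_orbit_le phi c : (forall u, phi (Tshift u f) <= c) -> sup_orbit phi <= c.
Proof.
move=> le_c; apply: ge_sup; first by exists (phi (Tshift tzero f)), tzero.
by move=> _ [u _ <-].
Qed.

Definition upper_mean (phi : Sd -> R) : R :=
  inf [set sup_orbit (avg s phi) | s in [set s | s != [::]]].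

Let lower phi M s : continuous phi -> (forall h, `|phi h| <= M) -> s != [::] ->
  - M <= sup_orbit (avg s phi).
Proof.
move=> cphi MP s0.
apply: le_trans (le_sup_orbit tzero (avg_continuous (s := s) cphi)).
rewrite lerNl -mulN1r -avgZ; apply: avg_le => // v.
rewrite mulN1r; apply: le_trans (MP (Tshift v (Tshift tzero f))).
by rewrite -normrN; exact: ler_norm.
Qed.

Lemma upper_mean_le phi s : continuous phi -> s != [::] ->
  upper_mean phi <= sup_orbit (avg s phi).
Proof.
move=> cphi s0; apply: ge_inf; last by exists s.
have [M MP] := continuous_bounded_Sd cphi.
by exists (- M) => _ [t t0 <-]; exact: lower.
Qed.

Lemma upper_mean_le_sup phi c : continuous phi -> (forall u, phi (Tshift u f) <= c) ->
  upper_mean phi <= c.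
Proof.
move=> cphi le_c; apply: (le_trans (@upper_mean_le phi [:: tzero] cphi isT)).
apply: sup_orbit_le => u; apply: avg_le => // v.
by rewrite Tshift_comp.
Qed.

Lemma upper_mean_ge phi c : (forall s, s != [::] -> c <= sup_orbit (avg s phi)) ->
  c <= upper_mean phi.
Proof.
move=> h; apply: lb_le_inf; first by exists (sup_orbit (avg [:: tzero] phi)), [:: tzero].
by move=> _ [s s0 <-]; exact: h.
Qed.

Lemma upper_mean_sublinear : sublinear_on [set phi : Sd -> R | continuous phi] upper_mean.
Proof.
apply: sublinear_on_inf.
- by move=> phi psi; exact: continuousD_fun.
- by move=> c phi; exact: continuousZ_fun.
- by exists [:: tzero].
- move=> s t phi psi /= s0 t0 cphi cpsi; exists [seq tadd v w | v <- s, w <- t].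
    by rewrite /= -size_eq0 size_allpairs muln_eq0 !size_eq0 negb_or s0.
  apply: sup_orbit_le => u.
  rewrite [leLHS](avgD _ phi psi (Tshift u f)); apply: lerD.
    rewrite avg_comp; apply: avg_le => // w; rewrite Tshift_comp.
    exact/le_sup_orbit/avg_continuous.
  rewrite avg_compC; apply: avg_le => // w; rewrite Tshift_comp.
  exact/le_sup_orbit/avg_continuous.
- move=> s c phi /= s0 c0 cphi; exists s => //.
  apply: sup_orbit_le => u; rewrite [leLHS](avgZ s c phi) ler_pM2l//.
  exact/le_sup_orbit/avg_continuous.
- move=> phi cphi; have [M MP] := continuous_bounded_Sd cphi.
  by exists (- M) => s s0; exact: lower.
Qed.

(* Telescoping along 0, v, 2v, ... *)
Lemma upper_mean_shift phi v : continuous phi ->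
  upper_mean (fun h => phi (Tshift v h) - phi h) <= 0.
Proof.
move=> cphi; have [M MP] := continuous_bounded_Sd cphi.
have cD : continuous (fun h => phi (Tshift v h) - phi h).
  by apply: continuousB_fun => //; exact: continuous_Tshift_comp.
apply/ler_addgt0Pr => e e0; rewrite add0r.
(* The telescoped sum is at most [2 * M], so this many terms bring its mean below [e]. *)
pose n := (Num.bound (2 * M / e)).+1.
pose s := traject (fun x => tadd x v) tzero n.
have s0 : s != [::] by rewrite -size_eq0 size_traject.
apply: (le_trans (upper_mean_le cD s0)); apply: sup_orbit_le => u.
set h := Tshift u f; rewrite /avg size_traject.
have tele m : \sum_(w <- traject (fun x => tadd x v) tzero m)
    (phi (Tshift v (Tshift w h)) - phi (Tshift w h)) =
   phi (Tshift (iter m (fun x => tadd x v) tzero) h) - phi h.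
  elim: m => [|m IH]; first by rewrite big_nil /= Tshift0 subrr.
  by rewrite trajectSr -cats1 big_cat /= IH big_seq1 Tshift_comp taddC; ring.
rewrite /s tele.
have n0 : 0 < n%:R :> R by rewrite ltr0n.
rewrite ler_pdivrMl//.
have M0 : 0 <= M by apply: le_trans (MP point).
have hn : 2 * M <= n%:R * e.
  rewrite -ler_pdivrMr// ltW// (lt_trans (archi_boundP _))//.
    by rewrite divr_ge0 ?mulr_ge0// ltW.
  by rewrite ltr_nat.
have := MP (Tshift (iter n (fun x => tadd x v) tzero) h); have := MP h.
by rewrite !ler_norml => /andP[? ?] /andP[? ?]; apply: le_trans hn; lra.
Qed.

End Shift.

(** * Tiling boxes by unit cubes *)

Section Grid.
Variable R : realType.
Local Notation leb := (@lebesgue_measure R).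

Lemma integral_itv_split (N : nat) (H : R -> \bar R) :
  measurable_fun setT H -> (forall t, 0 <= H t)%E ->
  (\int[leb]_t ((\1_`[0, N%:R] t)%:E * H t) =
   \sum_(k <- iota 0 N) \int[leb]_t ((\1_`[0%R, 1%R] t)%:E * H (t + k%:R)%R))%E.
Proof.
move=> mH H0.
have itvE (D : set R) (G : R -> \bar R) : measurable D ->
    (\int[leb]_t ((\1_D t)%:E * G t) = \int[leb]_(t in D) G t)%E.
  move=> mD; rewrite [RHS]integral_mkcond; apply: eq_integral => t _.
  by rewrite patchE indicE; case: ifP => _; rewrite ?mul1e ?mul0e.
elim: N => [|N IH].
  rewrite big_nil itvE//= set_itv1 integral_set1//.
rewrite -addn1 iotaD big_cat /= big_seq1 add0n -IH !itvE//.
(* Closed unit intervals share endpoints. The new piece is taken half-open to be disjoint from the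
   old ones, then closed at no change of the integral. *)
rewrite (_ : `[0, (N + 1)%:R]%classic =
    `[0, N%:R]%classic `|` `]N%:R, (N + 1)%:R]%classic); last first.
  apply/seteqP; split => t /=; rewrite !in_itv/=.
    move=> /andP[t0 tN]; case: (leP t N%:R) => tN'; [left|right] => //.
    by rewrite t0.
  rewrite natrD; have : 0 <= N%:R :> R by []. 
  by move=> N0 [|] /andP[h1 h2]; apply/andP; split; lra.
rewrite ge0_integral_setU//; last 2 first.
- exact: measurable_funTS.
- apply/disj_set2P; apply/seteqP; split => // t /= []; rewrite !in_itv/=.
  by move=> /andP[_ h1] /andP[h2 _]; have := le_lt_trans h1 h2; rewrite ltxx.
congr (_ + _)%E.
rewrite integral_itv_obnd_cbnd; last exact: measurable_funTS.
rewrite -[LHS]itvE//.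
rewrite -(@ge0_integral_translation R N%:R
  (fun t => (\1_`[N%:R, (N + 1)%:R] t)%:E * H t)%E); last 2 first.
- apply: emeasurable_funM => //; apply/measurable_EFinP.
  by apply: measurable_indic.
- by move=> t; rewrite mule_ge0.
rewrite -[RHS]itvE//; apply: eq_integral => t _; congr (EFin _ * _)%E.
rewrite !indicE; congr ((nat_of_bool _)%:R).
by apply/idP/idP; rewrite !inE/= !in_itv/= natrD => /andP[h1 h2]; apply/andP; split; lra.
Qed.

Definition cbox n (N : nat) : set (n.-tuple R) := [set x | forall i, 0 <= tnth x i <= N%:R].

Lemma cbox_measurable n N : measurable (@cbox n N).
Proof. exact: (measurable_box (fun=> 0) (fun=> N%:R)). Qed.

Lemma indic_cbox_cons n N t (v : n.-tuple R) :
  \1_(cbox N) [tuple of t :: v] = \1_`[0, N%:R] t * \1_(cbox N) v :> R.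
Proof.
rewrite !indicE -natrM mulnb; congr ((nat_of_bool _)%:R); apply/idP/andP; rewrite !inE.
  move=> h; split; first by have := h ord0; rewrite /= in_itv /=.
  by move=> i; have := h (lift ord0 i); rewrite tnthS.
rewrite /= in_itv /= => -[h0 h] i.
by case: (unliftP ord0 i) => [j ->|->//]; rewrite tnthS.
Qed.

Fixpoint grid (n N : nat) : seq (n.-tuple R) :=
  match n return seq (n.-tuple R) with
  | 0 => [:: [tuple]]
  | n'.+1 => [seq [tuple of (k%:R : R) :: (v : n'.-tuple R)] | k <- iota 0 N, v <- grid n' N]
  end.

Lemma size_grid n N : size (grid n N) = (N ^ n)%N.
Proof. by elim: n => //= n IH; rewrite size_allpairs size_iota IH expnS. Qed.

Lemma iint_cbox_grid n N (G : n.-tuple R -> \bar R) :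
  measurable_fun setT G -> (forall x, 0 <= G x)%E ->
  iint (fun x => (\1_(cbox N) x)%:E * G x)%E =
  (\sum_(k <- grid n N) iint (fun x => (\1_(cbox 1) x)%:E * G (tadd x k)))%E.
Proof.
elim: n G => [|n IH] G mG G0.
  rewrite /= big_seq1; congr (EFin _ * G _)%E; last by rewrite [RHS]tuple0.
  rewrite !indicE; congr ((nat_of_bool _)%:R); apply/idP/idP; rewrite !inE => _ [] //.
(* Translating the tail by [k] is a measurable map of the full tuple, which brings the inner
   integral into the form of [measurable_iint_cons]. *)
have mK (k : n.-tuple R) : measurable_fun setT
    (fun t : R => iint (fun v => (\1_(cbox 1) v)%:E * G [tuple of t :: tadd v k])%E).
  have mtk : measurable_fun setT
      (fun x : n.+1.-tuple R => [tuple of thead x :: tadd [tuple of behead x] k]).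
    apply: measurable_cons; first exact: measurable_tnth.
    apply: (measurableT_comp (measurable_tadd k)). exact: measurable_behead.
  have := @measurable_iint_cons R n (fun x => (\1_(@cbox n 1) [tuple of behead x])%:E *
    G [tuple of thead x :: tadd [tuple of behead x] k])%E.
  move=> h; have := h _ _; rewrite (_ : (fun t => iint _) =
    (fun t => iint (fun v => (\1_(cbox 1) v)%:E * G [tuple of t :: tadd v k])%E)).
    apply.
      apply: emeasurable_funM; last exact: (measurableT_comp mG mtk).
      apply/measurable_EFinP.
      have mi : measurable_fun setT (\1_(@cbox n 1) : _ -> R).
        by apply: measurable_indic; exact: cbox_measurable.
      by apply: (measurableT_comp mi); exact: measurable_behead.
    by move=> x; rewrite mule_ge0.
  apply/funext => t; apply: eq_iint => v.
  have -> : [tuple of behead [tuple of t :: v]] = v by apply/val_inj.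
  by rewrite theadE.
have K0 k t : (0 <= iint (fun v => (\1_(cbox 1) v)%:E * G [tuple of t :: tadd v k]))%E.
  by apply: iint_ge0 => v; rewrite mule_ge0.
have step M (F : n.+1.-tuple R -> \bar R) t :
    iint (fun v => (\1_(cbox M) [tuple of t :: v])%:E * F [tuple of t :: v])%E =
    ((\1_`[0%R, M%:R] t)%:E * iint (fun v => (\1_(cbox M) v)%:E * F [tuple of t :: v]))%E.
  under eq_iint do rewrite indic_cbox_cons.
  rewrite indicE; case: (_ \in _) => /=.
    by rewrite mul1e; apply: eq_iint => v; rewrite mul1r.
  by rewrite mul0e -[RHS](iint0 R n); apply: eq_iint => v; rewrite mul0r mul0e.
rewrite [LHS]/=; under eq_integral do rewrite step.
have IHt t : iint (fun v => (\1_(cbox N) v)%:E * G [tuple of t :: v])%E =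
    (\sum_(k <- grid n N) iint (fun v => (\1_(cbox 1) v)%:E * G [tuple of t :: tadd v k]))%E.
  by apply: (IH (fun v => G [tuple of t :: v])) => //; exact: measurable_fun_cons.
under eq_integral do rewrite IHt.
rewrite integral_itv_split; last 2 first.
- by apply: emeasurable_sum => k; exact: mK.
- by move=> t; apply: sume_ge0 => k _; exact: K0.
rewrite /= big_allpairs_dep; apply: eq_bigr => k0 _.
under eq_integral do rewrite ge0_sume_distrr//.
rewrite ge0_integral_sum//; last 2 first.
- move=> k; apply: emeasurable_funM; first by apply/measurable_EFinP; exact: measurable_indic.
  apply: (measurableT_comp (mK k)); exact: measurable_funD.
- by move=> k t _; rewrite mule_ge0.
apply: eq_bigr => k _; apply: eq_integral => t _.
rewrite (step 1%N (fun x => G (tadd x [tuple of k0%:R :: k]))); congr (_ * _)%E.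
by apply: eq_iint => v; rewrite tadd_cons.
Qed.

End Grid.

(** * The upper Banach density as an upper mean *)

Lemma ler_size_sum (R : realDomainType) (I : eqType) (s : seq I) (F : I -> R) a :
  (forall x, x \in s -> a <= F x) -> (size s)%:R * a <= \sum_(x <- s) F x.
Proof.
elim: s => [|y s IH] h; first by rewrite mul0r big_nil.
rewrite big_cons /= -natr1 mulrDl mul1r addrC lerD ?h ?mem_head//.
by apply: IH => x xs; rewrite h// inE xs orbT.
Qed.

Lemma ler_sum_size (R : realDomainType) (I : eqType) (s : seq I) (F : I -> R) b :
  (forall x, x \in s -> F x <= b) -> \sum_(x <- s) F x <= (size s)%:R * b.
Proof.
move=> h; rewrite -lerN2 -mulrN -sumrN.
by apply: ler_size_sum => x xs; rewrite lerN2 h.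
Qed.

Section Mass.
Variables (R : realType) (d : nat).
Local Notation Sd := (Defs.Sd R d).
Local Notation P := (gauss_prob R d).
Implicit Types (h : Sd).

Lemma iint_cbox1 n : iint (fun x : n.-tuple R => (\1_(cbox 1) x)%:E) = 1%E.
Proof.
elim: n => [|n IH].
  by rewrite /= indicE mem_set// => -[].
rewrite [LHS]/= (_ : 1%E = (\int[@lebesgue_measure R]_t (\1_`[0%R, 1%R] t)%:E)%E); last first.
  rewrite integral_indic// setIT -[RHS]/(@lebesgue_measure R `[0%R, 1%R]%classic).
  rewrite lebesgue_measure_itv/= lte_fin ltr01.
  by rewrite -EFinB subr0.
apply: eq_integral => t _.
under eq_iint do rewrite indic_cbox_cons.
rewrite indicE; case: (_ \in _) => /=.
  by rewrite -IH; apply: eq_iint => v; rewrite mul1r.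
by rewrite -[RHS](iint0 R n); apply: eq_iint => v; rewrite mul0r.
Qed.

Lemma indic_unit_cube_integrable : integrable_Rd (\1_(@unit_cube R d) : d.-tuple R -> R).
Proof.
split; first by apply: measurable_indic; exact: (@cbox_measurable R d 1).
under eq_iint do rewrite ger0_norm//.
by rewrite (iint_cbox1 d) ltry.
Qed.

(** Going through [pairing] makes this real form of [cube_mass] weak-* continuous. *)
Definition unit_mass h : R := pairing h (\1_(@unit_cube R d)).

Lemma unit_mass_continuous : continuous unit_mass.
Proof.
rewrite (_ : unit_mass = wpair (fun x => \1_(@unit_cube R d) x / gauss_weight x)).
  exact/wpair_continuous/integrable_Rd_div/indic_unit_cube_integrable.
by apply/funext => h; rewrite /unit_mass pairingE//; exact: indic_unit_cube_integrable.
Qed.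

Lemma cube_massE h : cube_mass h = (unit_mass h)%:E.
Proof.
have mi : measurable_fun setT (\1_(@unit_cube R d) : d.-tuple R -> R).
  by apply: measurable_indic; exact: (@cbox_measurable R d 1).
rewrite /unit_mass /pairing [X in _ - fine X](_ : _ = 0%E); last first.
  by rewrite -[RHS](iint0 R d); apply: eq_iint => x; rewrite max_r ?mulr0// oppr_le0.
rewrite subr0 (@eq_iint R d _ (fun x => (\1_(@unit_cube R d) x * Defs.sfun h x)%:E)); last first.
  by move=> x; rewrite max_l// mulrC.
rewrite fineK// ge0_fin_numE; last first.
  by apply: iint_ge0 => x; rewrite lee_fin mulr_ge0// sfun_ge0.
apply: le_lt_trans (ltry 1); rewrite -(iint_cbox1 d); apply: le_iint.
- by apply/measurable_EFinP; apply: measurable_funM => //; exact: sfun_meas.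
- exact/measurable_EFinP.
- by move=> x; rewrite lee_fin mulr_ge0// sfun_ge0.
- by move=> x; rewrite lee_fin ler_piMr// sfun_le1.
Qed.

Lemma unit_mass_ge0 h : 0 <= unit_mass h.
Proof.
by rewrite -lee_fin -cube_massE; apply: iint_ge0 => x; rewrite lee_fin mulr_ge0// sfun_ge0.
Qed.

Lemma box_massE N h : iint (fun x => (\1_(cbox N) x * Defs.sfun h x)%:E) =
  (\sum_(k <- grid R d N) unit_mass (Tshift k h))%:E.
Proof.
rewrite (@iint_cbox_grid R d N (EFin \o Defs.sfun h)); last 2 first.
- by apply/measurable_EFinP; exact: sfun_meas.
- by move=> x; rewrite lee_fin sfun_ge0.
by rewrite -sumEFin; apply: eq_bigr => k _; rewrite -cube_massE.
Qed.

Lemma iint_shifted_box N u h :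
  iint (fun x => (\1_(cbox N) (tadd x (topp u)) * Defs.sfun h x)%:E) =
  (\sum_(k <- grid R d N) unit_mass (Tshift k (Tshift u h)))%:E.
Proof.
rewrite -box_massE.
under [LHS]eq_iint do rewrite mulrC.
under [RHS]eq_iint do rewrite mulrC.
by rewrite iint_shift//; apply: measurable_indic; exact: (@cbox_measurable R d _).
Qed.

Lemma sum_grid_avg N h : (0 < N)%N ->
  \sum_(k <- grid R d N) unit_mass (Tshift k h) = (N%:R ^+ d) * avg (grid R d N) unit_mass h.
Proof.
move=> N0; rewrite /avg size_grid natrX mulrA mulfV ?mul1r//.
by rewrite expf_neq0// pnatr_eq0 -lt0n.
Qed.

Variable f : Sd.

(** The mean of [unit_mass] over the integer grid, evaluated on the orbit, is the mean of [f] over a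
    single cube of side [N]; this grid is one of the families in the infimum. *)
Lemma upper_mean_le_sup_avg N : (0 < N)%N ->
  ((upper_mean f unit_mass)%:E <= sup_avg f N%:R)%E.
Proof.
move=> N0.
have g0 : grid R d N != [::] by rewrite -size_eq0 size_grid expn_eq0 -leqn0 leqNgt N0.
have elt u : ((avg (grid R d N) unit_mass (Tshift u f))%:E <= sup_avg f N%:R)%E.
  (* Boxes are indexed by their lower corner and cubes by their centre, whence the shift by
     [N / 2]. *)
  apply: ereal_sup_ubound; exists (tadd u [tuple N%:R / 2 | i < d]) => //.
  rewrite (@eq_iint R d _ (fun x => (\1_(cbox N) (tadd x (topp u)) * Defs.sfun f x)%:E)).
    rewrite iint_shifted_box sum_grid_avg// -EFinM mulrAC mulfV ?mul1r//.
    by rewrite expf_neq0// pnatr_eq0 -lt0n.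
  move=> x; congr (_ * _)%:E; rewrite !indicE; congr ((nat_of_bool _)%:R).
  apply/idP/idP; rewrite !inE => h i; have := h i; rewrite !tnth_mktuple.
    by move=> /andP[h1 h2]; apply/andP; split; lra.
  by move=> /andP[h1 h2]; apply/andP; split; lra.
case E : (sup_avg f N%:R) => [r| |]; rewrite ?leey//.
  rewrite lee_fin; apply: (le_trans (upper_mean_le f unit_mass_continuous g0)).
  by apply: sup_orbit_le => u; have := elt u; rewrite E lee_fin.
by have := elt (tzero R d); rewrite E.
Qed.

Lemma upper_mean_le_dstar : ((upper_mean f unit_mass)%:E <= dstar f)%E.
Proof.
apply/ereal_infP => _ [T /= T0 <-].
have bT := archi_boundP (ltW T0).
apply: (le_trans (@upper_mean_le_sup_avg (Num.bound T) _)).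
  by rewrite -(ltr_nat R); exact: lt_trans bT.
by apply: ereal_sup_ubound; exists (Num.bound T)%:R => //=; exact: ltW.
Qed.

(** A bound linear in [y] shows that the volume ratio of the enlarged cube exceeds 1 by a quantity
    of order 1/t. *)
Lemma expr_1D_le n (y : R) : 0 <= y <= 1 -> (1 + y) ^+ n <= 1 + y * 2 ^+ n.
Proof.
(* The sharper bound is the chord of this convex function between 0 and 1, and it is the one that
   passes through the induction. *)
move=> /andP[y0 y1]; apply: (@le_trans _ _ (1 + y * (2 ^+ n - 1))).
  elim: n => [|n IH]; first by rewrite !expr0 subrr mulr0 addr0.
  have z1 : 1 <= 2 ^+ n :> R by rewrite exprn_ege1// ler1n.
  rewrite !exprS; have h := ler_wpM2l (addr_ge0 ler01 y0) IH.
  apply: (le_trans h); set z := 2 ^+ n in z1 *; rewrite -subr_ge0.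
  rewrite (_ : _ - _ = y * (z - 1) * (1 - y)); last by ring.
  by rewrite !mulr_ge0// subr_ge0.
by rewrite lerD2l ler_wpM2l// gerBl.
Qed.

(* A cube of side [t] is contained in all the translates by [s] of a slightly larger cube. *)
Lemma cube_mass_le s (r t : R) (N : nat) v :
  s != [::] -> (forall x i, x \in s -> `|tnth x i| <= r) -> t + 2 * r <= N%:R ->
  (iint (fun x => (\1_(cube v t) x * Defs.sfun f x)%:E) <=
   (N%:R ^+ d * sup_orbit f (avg s unit_mass))%:E)%E.
Proof.
move=> s0 sr tN.
(* Lower corner of the enlarged box: the margin [r] on each side absorbs the displacement by any [x]
   in [s]. *)
set u : d.-tuple R := tadd v [tuple - (t / 2 + r) | i < d].
set A := iint _.
have A0 : (0 <= A)%E by apply: iint_ge0 => x; rewrite lee_fin mulr_ge0// sfun_ge0.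
have mc : measurable (cube v t).
  exact: (measurable_box (fun i => tnth v i - t / 2) (fun i => tnth v i + t / 2)).
have Ax x : x \in s ->
    (A <= (\sum_(k <- grid R d N) unit_mass (Tshift k (Tshift (tadd x u) f)))%:E)%E.
  move=> xs; rewrite -iint_shifted_box; apply: le_iint.
  - apply/measurable_EFinP; apply: measurable_funM; last exact: sfun_meas.
    exact: measurable_indic.
  - apply/measurable_EFinP; apply: measurable_funM; last exact: sfun_meas.
    apply: (measurableT_comp _ (measurable_tadd (topp (tadd x u)))).
    by apply: measurable_indic; exact: (@cbox_measurable R d _).
  - by move=> y; rewrite lee_fin mulr_ge0// sfun_ge0.
  - move=> y; rewrite lee_fin ler_wpM2r ?sfun_ge0//.
    rewrite !indicE ler_nat; case: (boolP (y \in _)) => // yQ.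
    rewrite lt0b mem_set// => i; move: yQ; rewrite inE => /(_ i).
    rewrite !tnth_mktuple => /andP[h1 h2].
    have := sr x i xs; rewrite ler_norml => /andP[h3 h4].
    by apply/andP; split; lra.
case: A A0 Ax => [a| |//] A0 Ax; last first.
  by case: s s0 Ax {sr} => // x s _ /(_ x (mem_head _ _)).
rewrite lee_fin.
have n0 : 0 < (size s)%:R :> R by rewrite ltr0n lt0n size_eq0.
have h1 : (size s)%:R * a <=
    \sum_(x <- s) \sum_(k <- grid R d N) unit_mass (Tshift x (Tshift k (Tshift u f))).
  have Ax' x : x \in s -> a <= \sum_(k <- grid R d N) unit_mass (Tshift x (Tshift k (Tshift u f))).
    move=> /Ax; rewrite lee_fin => h; apply: (le_trans h); rewrite le_eqVlt; apply/orP; left.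
    apply/eqP/eq_bigr => k _; rewrite !Tshift_comp; congr (unit_mass (Tshift _ f)).
    by rewrite !taddA [tadd k x]taddC.
  exact: ler_size_sum.
have h2 : \sum_(x <- s) \sum_(k <- grid R d N) unit_mass (Tshift x (Tshift k (Tshift u f))) <=
    (size s)%:R * (N%:R ^+ d * sup_orbit f (avg s unit_mass)).
  rewrite exchange_big /= mulrCA -natrX -(size_grid R d N).
  apply: ler_sum_size => k _; rewrite -ler_pdivrMl// (Tshift_comp k u f).
  rewrite -[leLHS]/(avg s unit_mass (Tshift (tadd k u) f)).
  exact/le_sup_orbit/avg_continuous/unit_mass_continuous.
by have := le_trans h1 h2; rewrite ler_pM2l.
Qed.

Lemma dstar_le_sup_orbit s : s != [::] ->
  (dstar f <= (sup_orbit f (avg s unit_mass))%:E)%E.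
Proof.
move=> s0; set S := sup_orbit _ _.
have S0 : 0 <= S.
  apply: (@le_trans _ _ (avg s unit_mass (Tshift (tzero R d) f))); last first.
    exact/le_sup_orbit/avg_continuous/unit_mass_continuous.
  by rewrite mulr_ge0 ?invr_ge0//; apply: sumr_ge0 => v _; exact: unit_mass_ge0.
apply/lee_addgt0Pr => e e0; rewrite -EFinD.
pose r : R := \sum_(x <- s) \sum_(i < d) `|tnth x i|.
have sr x i : x \in s -> `|tnth x i| <= r.
  move=> xs; rewrite /r (big_rem x)//= (bigD1 i)//= -addrA lerDl addr_ge0//.
    by apply: sumr_ge0.
  by apply: sumr_ge0 => y _; apply: sumr_ge0.
have r0 : 0 <= r by apply: sumr_ge0 => y _; apply: sumr_ge0.
(* The side is rounded up to an integer, so it exceeds [t] by at most [2 * r + 1]. *)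
pose c : R := 2 * r + 1.
have c0 : 0 < c by rewrite /c; lra.
(* The first summand ensures [c / t <= 1], as [expr_1D_le] requires; the second makes the error
   [c * 2 ^+ d * S / t] at most [e]. *)
pose T := c + c * 2 ^+ d * S / e.
have q0 : 0 <= c * 2 ^+ d * S / e by rewrite divr_ge0 ?(ltW e0)// !mulr_ge0// ?(ltW c0)// exprn_ge0.
have T0 : 0 < T by rewrite /T; lra.
apply: (@le_trans _ _ (ereal_sup [set sup_avg f t | t in [set t | T <= t]])).
  by apply: ereal_inf_lbound; exists T.
apply: ge_ereal_sup => _ [t /= Tt <-]; apply: ge_ereal_sup => _ [v _ <-].
have t0 : 0 < t by exact: lt_le_trans Tt.
pose N := (Num.truncn (t + 2 * r)).+1.
have tr0 : 0 <= t + 2 * r by rewrite addr_ge0 ?(ltW t0)// mulr_ge0.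
have /andP[N1 N2] := truncn_itv tr0.
have NtR : N%:R <= t + c by rewrite /N -natr1 /c; lra.
have tN : t + 2 * r <= N%:R by exact: ltW.
have td0 : 0 < t ^+ d by rewrite exprn_gt0.
apply: (@le_trans _ _ ((N%:R ^+ d * S)%:E * ((t ^+ d)^-1)%:E)%E).
  apply: lee_wpmul2r; first by rewrite lee_fin invr_ge0 ltW.
  exact: (@cube_mass_le s r t N v s0 sr tN).
rewrite -EFinM lee_fin.
have y01 : 0 <= c / t <= 1.
  by rewrite divr_ge0 ?(ltW c0) ?(ltW t0)//= ler_pdivrMr// mul1r; move: Tt; rewrite /T; lra.
have NP : N%:R ^+ d / t ^+ d <= 1 + c / t * 2 ^+ d.
  apply: le_trans (expr_1D_le d y01); rewrite -expr_div_n lerXn2r// ?nnegrE.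
  - by rewrite divr_ge0// ltW.
  - by rewrite addr_ge0//; case/andP: y01.
  - by rewrite ler_pdivrMr// mulrDl mul1r divfK ?gt_eqF.
rewrite mulrAC; apply: (le_trans (ler_wpM2r S0 NP)).
rewrite mulrDl mul1r lerD2l.
rewrite (_ : c / t * 2 ^+ d * S = c * 2 ^+ d * S / t); last by ring.
rewrite ler_pdivrMr// -ler_pdivrMl// [_^-1 * _]mulrC.
by move: Tt; rewrite /T; lra.
Qed.

Lemma dstarE : dstar f = (upper_mean f unit_mass)%:E.
Proof.
apply/eqP; rewrite eq_le upper_mean_le_dstar andbT.
have := dstar_le_sup_orbit; have := upper_mean_le_dstar.
case: (dstar f) => [a| |]; rewrite ?leNye//.
  move=> _ h; rewrite lee_fin; apply: upper_mean_ge => s s0.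
  by have := h s s0; rewrite lee_fin.
by move=> _ /(_ [:: tzero R d] isT).
Qed.

End Mass.

(** * Invariant measures on the orbit closure *)

Section OrbitClosure.
Variables (R : realType) (d : nat).
Local Notation Sd := (Defs.Sd R d).
Local Notation SdB := (Defs.SdB R d).
Local Notation C := [set phi : Sd -> R | continuous phi].
Implicit Types (phi : Sd -> R) (mu : probability SdB R) (A : set SdB).

Lemma Tshift_measurable v : measurable_fun setT (Tshift v : SdB -> SdB).
Proof.
apply: (@measurability _ _ SdB SdB setT _ (@Defs.wopen R d)) => // _ [U oU <-].
rewrite setTI; apply: wopen_measurable.
exact: (@continuousP _ _ _).1 (@Tshift_continuous R d v) U oU.
Qed.

Lemma Tshift_image_measurable v A : measurable A -> measurable (Tshift v @` A : set SdB).
Proof.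
by move=> mA; rewrite Tshift_image -[_ @^-1` _]setTI; exact: Tshift_measurable.
Qed.

Definition quasi_invariant mu A := forall v : d.-tuple R,
  mu ((Tshift v @` A `\` A) `|` (A `\` Tshift v @` A)) = 0%E.

Lemma quasi_invariantC mu A : quasi_invariant mu A -> quasi_invariant mu (~` A).
Proof.
move=> qA v; rewrite -[RHS](qA v); congr (mu _).
rewrite !Tshift_image preimage_setC !setDE !setCK setUC.
by rewrite [~` A `&` _]setIC [_ `&` A]setIC.
Qed.

Lemma quasi_invariantT mu : quasi_invariant mu setT.
Proof.
by move=> v; rewrite Tshift_image preimage_setT setDv setU0 measure0.
Qed.

(** Change of variables replaces the domain [A] by its translate, which differs from [A] by a null
    set. *)
Lemma Rintegral_shift mu A phi v : T_invariant mu -> measurable A ->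
  quasi_invariant mu A -> continuous phi ->
  \int[mu]_(h in A) phi (Tshift v h) = \int[mu]_(h in A) phi h.
Proof.
move=> imu mA qA cphi.
pose B : set SdB := Tshift v @` A.
have mB : measurable B by exact: Tshift_image_measurable.
have preB : Tshift v @^-1` B = A.
  by rewrite /B Tshift_image; apply/seteqP; split => h /=; rewrite TshiftK.
have cphiv : continuous (fun h => phi (Tshift v h)) by exact: continuous_Tshift_comp.
have mphi : measurable_fun [set: SdB] (EFin \o phi).
  by apply/measurable_EFinP; exact: continuous_measurable_Sd.
rewrite /Rintegral; congr fine.
transitivity (\int[pushforward mu (Tshift v : SdB -> SdB)]_(h in B) (phi h)%:E)%E.
  rewrite (integral_pushforward (@Tshift_measurable v) mphi)// preB//.
  exact: continuous_integrable_Sd.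
transitivity (\int[mu]_(h in B) (phi h)%:E)%E.
  by apply: eq_measure_integral => [|mTv E mE _]; [exact: Tshift_measurable|exact: (imu v E mE)].
rewrite [LHS]integral_mkcond [RHS]integral_mkcond; apply: ae_eq_integral => //.
- by apply/(measurable_restrictT _ _).1 => //; exact: measurable_funTS.
- by apply/(measurable_restrictT _ _).1 => //; exact: measurable_funTS.
exists ((B `\` A) `|` (A `\` B)); split; last 1 first.
- move=> h /= nh; apply: contrapT => /not_orP[/not_andP hBA /not_andP hAB]; apply: nh => _.
  rewrite !patchE; have [Ah|nAh] := pselect (A h); have [Bh|nBh] := pselect (B h).
  + by rewrite !mem_set.
  + by case: hAB.
  + by case: hBA.
  + by rewrite !memNset.
- by apply: measurableU; apply: measurableD.
- exact: qA.
Qed.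

Variable f : Sd.
Let X : set SdB := wclosure (range (fun v : d.-tuple R => Tshift v f)).

Lemma closure_le_sup_orbit phi h : continuous phi -> X h -> phi h <= sup_orbit f phi.
Proof.
move=> cphi Xh; rewrite leNgt; apply/negP => lt_h.
have oU : open [set g : Sd | 0 < phi g - sup_orbit f phi].
  by apply: open_gt0; apply: continuousB_fun => //; exact: continuous_cst_fun.
have [|g [/= + [v _ gE]]] := Xh _ oU; first by rewrite /= subr_gt0.
by rewrite -gE subr_gt0 ltNge le_sup_orbit.
Qed.

(** The complement of [X] is the union of the countably many base sets that miss the orbit. Both the
    measurability of [X] and its full measure reduce to these sets. *)
Let F n : set SdB := if pselect (forall v, @base_bump R d n (Tshift v f) = 0) is left _
  then [set h | 0 < @base_bump R d n h] else set0.

Let setCX : ~` X = \bigcup_n F n.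
Proof.
apply/seteqP; split => [h /= nXh|h [n _]].
  have [U [oU Uh UX]] : exists U : set Sd, [/\ Defs.wopen U, U h & forall v, ~ U (Tshift v f)].
    apply: contrapT => noU; apply: nXh => U oU Uh; apply: contrapT => UX.
    apply: noU; exists U; split => // v Uv; apply: UX.
    by exists (Tshift v f); split => //; exists v.
  have [n [n0 nU]] := @base_bumpP R d U h oU Uh.
  exists n => //; rewrite /F; case: pselect => // -[] v.
  by apply/eqP; rewrite eq_le base_bump_ge0 andbT leNgt; apply/negP => /nU /UX.
rewrite /F; case: pselect => // n0 /= hn Xh.
have := closure_le_sup_orbit (@base_bump_continuous R d n) Xh.
rewrite leNgt => /negP; apply; apply: le_lt_trans hn.
by apply: sup_orbit_le => v; rewrite n0.
Qed.

Let mF n : measurable (F n).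
Proof.
rewrite /F; case: pselect => // _; apply: wopen_measurable; apply: open_gt0.
exact: base_bump_continuous.
Qed.

Lemma closure_measurable : measurable X.
Proof. by rewrite -[X]setCK; apply: measurableC; rewrite setCX; exact: bigcupT_measurable. Qed.

Lemma closure_full mu : (forall b : Sd -> R, continuous b -> (forall h, 0 <= b h) ->
    (forall v, b (Tshift v f) = 0) -> mu [set h | 0 < b h] = 0%E) -> mu X = 1%E.
Proof.
move=> null.
have mCX : mu (~` X) = 0%E.
  apply/negligibleP; first by apply: measurableC; exact: closure_measurable.
  rewrite setCX; apply: negligible_bigcup => n; apply/negligibleP => //.
  rewrite /F; case: pselect => [n0|_]; last exact: measure0.
  by apply: null => //; [exact: base_bump_continuous|exact: base_bump_ge0].
rewrite -[X]setCK probability_setC; first by rewrite mCX sube0.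
by apply: measurableC; exact: closure_measurable.
Qed.

Lemma Rintegral_le_sup_orbit mu A phi : mu X = 1%E -> measurable A -> continuous phi ->
  \int[mu]_(h in A) phi h <= fine (mu A) * sup_orbit f phi.
Proof.
move=> muX mA cphi; set S := sup_orbit f phi.
have cS : continuous (fun _ : Sd => S) by exact: continuous_cst_fun.
(* The bound by [S] is available only on [X]; truncation makes it hold everywhere and alters [phi]
   on a null set only. *)
have cm : continuous (fun h => Num.min (phi h) S) by exact: continuous_min_fun.
rewrite (_ : \int[mu]_(h in A) phi h = \int[mu]_(h in A) Num.min (phi h) S).
  rewrite mulrC -Rintegral_cst//; apply: le_Rintegral => //.
  - exact: continuous_integrable_Sd.
  - exact: continuous_integrable_Sd.
  - by move=> h _; rewrite ge_min lexx orbT.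
rewrite /Rintegral; congr fine; apply: ae_eq_integral => //.
- by apply/measurable_EFinP; exact: (measurable_funTS (continuous_measurable_Sd cphi)).
- by apply/measurable_EFinP; exact: (measurable_funTS (continuous_measurable_Sd cm)).
have mCX : mu (~` X) = 0%E.
  by rewrite probability_setC ?muX ?subee//; exact: closure_measurable.
exists (~` X); split; first by apply: measurableC; exact: closure_measurable.
- exact: mCX.
- move=> h /= nh Xh; apply: nh => _; rewrite /= min_l//.
  exact: closure_le_sup_orbit.
Qed.

Lemma Rintegral_avg mu A phi s : T_invariant mu -> measurable A -> quasi_invariant mu A ->
  continuous phi -> s != [::] ->
  \int[mu]_(h in A) avg s phi h = \int[mu]_(h in A) phi h.
Proof.
move=> imu mA qA cphi s0.
have cs t : continuous (fun h => \sum_(v <- t) phi (Tshift v h)).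
  by apply: continuous_sum_fun => v; exact: continuous_Tshift_comp.
rewrite /avg RintegralZl//; last exact: continuous_integrable_Sd.
have -> : \int[mu]_(h in A) (\sum_(v <- s) phi (Tshift v h)) =
    (size s)%:R * \int[mu]_(h in A) phi h.
  elim: s {s0} => [|v s IH].
    by under eq_Rintegral do rewrite big_nil; rewrite Rintegral_cst// !mul0r.
  under eq_Rintegral do rewrite big_cons.
  rewrite RintegralD//; last 2 first.
  - by apply: continuous_integrable_Sd => //; exact: continuous_Tshift_comp.
  - exact: continuous_integrable_Sd.
  by rewrite IH Rintegral_shift//= -natr1 mulrDl mul1r addrC.
by rewrite mulrA mulVf ?mul1r// pnatr_eq0 size_eq0.
Qed.

(** For the whole space this is the upper bound on all invariant measures. For an invariant set and
    its complement it says that the normalised restrictions of [mu] are again dominated by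
    [upper_mean], which is what extremality is tested on. *)
Lemma Rintegral_le_upper_mean mu A phi : T_invariant mu -> mu X = 1%E ->
  measurable A -> quasi_invariant mu A -> continuous phi ->
  \int[mu]_(h in A) phi h <= fine (mu A) * upper_mean f phi.
Proof.
move=> imu muX mA qA cphi.
have le_s s : s != [::] -> \int[mu]_(h in A) phi h <= fine (mu A) * sup_orbit f (avg s phi).
  move=> s0; rewrite -(Rintegral_avg imu mA qA cphi s0).
  by apply: Rintegral_le_sup_orbit => //; exact: avg_continuous.
have : 0 <= fine (mu A) by exact: fine_ge0.
rewrite le0r => /orP[/eqP A0|A0].
  by have := le_s [:: tzero R d] isT; rewrite A0 !mul0r.
rewrite -ler_pdivrMl//; apply: upper_mean_ge => s s0.
by rewrite ler_pdivrMl// le_s.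
Qed.

Lemma integral_cube_mass mu : (\int[mu]_h cube_mass h)%E = (\int[mu]_h unit_mass h)%:E.
Proof.
rewrite /Rintegral fineK; first by apply: eq_integral => h _; exact: cube_massE.
apply: integrable_fin_num => //; apply: continuous_integrable_Sd => //.
exact: unit_mass_continuous.
Qed.

Lemma integral_cube_mass_le mu : T_invariant mu -> mu X = 1%E ->
  (\int[mu]_h cube_mass h <= dstar f)%E.
Proof.
move=> imu muX; rewrite integral_cube_mass dstarE lee_fin.
have := @Rintegral_le_upper_mean mu setT (@unit_mass R d) imu muX measurableT
  (@quasi_invariantT mu) (@unit_mass_continuous R d).
by rewrite (_ : fine (mu setT) = 1) ?mul1r// [X in fine X](@probability_setT _ _ _ mu).
Qed.

(** * The measure of an extreme dominated functional *)

Section MaximizingState.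
Variable L : (Sd -> R) -> R.
Hypotheses (linL : linear_on C L) (leL : le_on C L (upper_mean f)).
Hypothesis extL : forall (a : R) L1 L2, 0 < a < 1 -> linear_on C L1 -> linear_on C L2 ->
    le_on C L1 (upper_mean f) -> le_on C L2 (upper_mean f) ->
    (forall phi, C phi -> a * L1 phi + (1 - a) * L2 phi = L phi) ->
    forall phi, C phi -> L1 phi = L phi.

Let LZ c phi : continuous phi -> L (fun h => c * phi h) = c * L phi.
Proof. by move=> cphi; exact: (linL.2 c phi). Qed.

(** Domination is applied to [-1 * phi], whose upper mean is at most 0. *)
Lemma state_ge0 phi : continuous phi -> (forall h, 0 <= phi h) -> 0 <= L phi.
Proof.
move=> cphi phi0; rewrite -oppr_le0 -mulN1r -LZ//.
have cN := @continuousZ_fun _ _ (-1) _ cphi.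
apply: (le_trans (leL cN)); apply: upper_mean_le_sup => // u.
by rewrite mulN1r oppr_le0.
Qed.

Lemma state1 : L (fun=> 1) = 1.
Proof.
have c1 : continuous (fun _ : Sd => 1 : R) by exact: continuous_cst_fun.
apply/eqP; rewrite eq_le; apply/andP; split.
  by apply: (le_trans (leL c1)); exact: upper_mean_le_sup.
rewrite -lerN2 -mulN1r -LZ//.
have cN := @continuousZ_fun _ _ (-1) _ c1.
apply: (le_trans (leL cN)); apply: upper_mean_le_sup => // u.
by rewrite mulr1.
Qed.

Lemma state_shift phi v : continuous phi -> L (phi \o Tshift v) = L phi.
Proof.
move=> cphi.
have cv : continuous (phi \o Tshift v) by exact: continuous_Tshift_comp.
have LB psi psi' : continuous psi -> continuous psi' ->
    L (fun h => psi h - psi' h) = L psi - L psi'.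
  move=> c1 c2; rewrite -mulN1r -LZ// -(linL.1 psi (fun h => -1 * psi' h))//; last first.
    exact: continuousZ_fun.
  by congr L; apply/funext => h; rewrite -[RHS]/(psi h + -1 * psi' h) mulN1r.
have le1 psi w : continuous psi -> L (psi \o Tshift w) <= L psi.
  move=> c1.
  have cw : continuous (psi \o Tshift w) by exact: continuous_Tshift_comp.
  rewrite -subr_le0 -LB//.
  have cB : continuous (fun h => psi (Tshift w h) - psi h) by exact: continuousB_fun.
  exact: le_trans (leL cB) (upper_mean_shift f w c1).
apply/eqP; rewrite eq_le le1//=.
rewrite [leLHS](_ : _ = L ((phi \o Tshift v) \o Tshift (topp v))); first exact: le1.
by congr L; apply/funext => h /=; rewrite TshiftNK.
Qed.

Variable mu : probability SdB R.
Hypothesis muE : forall A, mu A = (mstar L A)%:E.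

Let intL phi : continuous phi -> \int[mu]_h phi h = L phi.
Proof. by move=> cphi; exact: (Rintegral_daniell linL state_ge0 state1 muE). Qed.

Lemma state_invariant : T_invariant mu.
Proof.
have le1 v A : mstar L (Tshift v @^-1` A) <= mstar L A.
  apply: mstar_preimage_le; [exact: state_ge0|exact: Tshift_continuous|].
  by move=> phi cphi; exact: state_shift.
move=> v A mA; rewrite !muE; congr EFin; apply/eqP; rewrite eq_le le1/=.
rewrite [leLHS](_ : _ = mstar L (Tshift (topp v) @^-1` (Tshift v @^-1` A))); first exact: le1.
by congr mstar; apply/seteqP; split => h /=; rewrite TshiftNK.
Qed.

(** A nonnegative continuous function that vanishes on the orbit has upper mean at most 0, so [L] is
    at most 0 on it and its positivity set is null. *)
Lemma state_closure : mu X = 1%E.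
Proof.
apply: closure_full => b cb b0 bf; rewrite muE (mstar_null_gt0 linL state_ge0)//.
apply: (le_trans (leL cb)); apply: upper_mean_le_sup => // v.
by rewrite bf.
Qed.

(* The restrictions of [mu] to an invariant set and to its complement would
   decompose [L]; hence [\int_A phi = mu A * L phi], and testing this on the
   covers defining [mstar L A = mu A] gives [1 <= mu A]. *)
Lemma state_ergodic : T_ergodic mu.
Proof.
move=> A mA qA.
have qAC := quasi_invariantC qA.
have mAC : measurable (~` A) by exact: measurableC.
pose a := fine (mu A).
have muA : mu A = a%:E by rewrite /a fineK// fin_num_measure.
have a0 : 0 <= a by exact: fine_ge0.
have a1 : a <= 1 by rewrite -lee_fin -muA; exact: probability_le1.
have muAC : fine (mu (~` A)) = 1 - a by rewrite probability_setC// muA.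
move: a0; rewrite le0r => /orP[/eqP a0|a0]; first by left; rewrite muA a0.
move: a1; rewrite le_eqVlt => /orP[/eqP a1|a1]; first by right; rewrite muA a1.
exfalso.
have linI (B : set SdB) (c : R) : measurable B ->
    linear_on C (fun phi => c * \int[mu]_(h in B) phi h).
  move=> mB; split=> [phi psi cphi cpsi|k phi cphi].
    by rewrite -mulrDr; congr (_ * _); apply: RintegralD => //; exact: continuous_integrable_Sd.
  by rewrite mulrCA; congr (_ * _); apply: RintegralZl => //; exact: continuous_integrable_Sd.
have leI (B : set SdB) (c : R) : measurable B -> quasi_invariant mu B -> 0 < c -> fine (mu B) = c ->
    le_on C (fun phi => c^-1 * \int[mu]_(h in B) phi h) (upper_mean f).
  move=> mB qB c0 Bc phi cphi; rewrite ler_pdivrMl// -Bc.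
  exact: (Rintegral_le_upper_mean state_invariant state_closure).
have a1' : 0 < 1 - a by rewrite subr_gt0.
have IA phi : continuous phi -> \int[mu]_(h in A) phi h = a * L phi.
  move=> cphi.
  have a01 : 0 < a < 1 by rewrite a0.
  have comb psi : C psi -> a * (a^-1 * \int[mu]_(h in A) psi h) +
      (1 - a) * ((1 - a)^-1 * \int[mu]_(h in ~` A) psi h) = L psi.
    move=> cpsi; rewrite !mulVKf ?gt_eqF// -Rintegral_setU//.
    - by rewrite setUv intL.
    - by rewrite setUv; exact: continuous_integrable_Sd.
    - by apply/disj_set2P; rewrite setICr.
  have E := (extL a01 (linI _ _ mA) (linI _ _ mAC) (leI A a mA qA a0 erefl)
    (leI _ _ mAC qAC a1' muAC) comb).
  have Ephi : a^-1 * \int[mu]_(h in A) phi h = L phi := E phi cphi.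
  rewrite -Ephi.
  by rewrite mulVKf// gt_eqF.
have : 1 <= mstar L A.
  apply: (mstar_ge state_ge0) => c psi [cp p0 pm Lc cov].
  (* Markov's inequality inside [A]: the mass of [B n] is at most the integral of [psi n] over [A],
     which is [a * L (psi n) <= a * c]. The sets [B n] increase to [A], so [a <= a * c]. *)
  pose B n : set SdB := A `&` [set h | 1 <= psi n h].
  have mB n : measurable (B n).
    apply: measurableI => //; rewrite (_ : [set _ | _] = ~` [set h | 0 < 1 - psi n h]).
      apply: measurableC; apply: wopen_measurable; apply: open_gt0.
      by apply: continuousB_fun => //; exact: continuous_cst_fun.
    by apply/seteqP; split => h /=; rewrite subr_gt0 => h1; [apply/negP|move/negP: h1];
      rewrite -leNgt.
  have BA : \bigcup_n B n = A.
    apply/seteqP; split => [h [n _ []]//|h Ah].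
    by have [n n1] := cov h Ah; exists n.
  have Bnd : {homo B : m n / (m <= n)%N >-> (m <= n)%O}.
    move=> m n mn; apply/subsetPset => h [Ah /= h1]; split => //=.
    exact: le_trans h1 (pm h m n mn).
  have Bc n : (mu (B n) <= (a * c)%:E)%E.
    rewrite -[mu (B n)]fineK ?fin_num_measure// lee_fin.
    apply: (@le_trans _ _ (\int[mu]_(h in A) psi n h)); last by rewrite IA// ler_pM2l.
    apply: (@le_trans _ _ (\int[mu]_(h in B n) psi n h)).
      rewrite -[leLHS]mul1r -Rintegral_cst//; apply: le_Rintegral => //.
      - by apply: continuous_integrable_Sd => //; exact: continuous_cst_fun.
      - exact: continuous_integrable_Sd.
      - by move=> h [].
    have BnA : B n `<=` A by move=> h [].
    have mD : measurable (A `\` B n) by exact: measurableD.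
    rewrite -[X in _ <= \int[mu]_(h in X) _](setDUK BnA) Rintegral_setU//.
    - by rewrite lerDl; apply: Rintegral_ge0 => h _; exact: p0.
    - by rewrite setDUK//; exact: continuous_integrable_Sd.
    - by apply/disj_set2P; rewrite setDIK.
  have muAc : (mu A <= (a * c)%:E)%E.
    have cv := nondecreasing_cvg_mu (mu := mu) mB (bigcupT_measurable _ mB) Bnd.
    rewrite -BA -(cvg_lim _ cv)//; apply: lime_le; first by apply/cvg_ex; eexists; exact: cv.
    by apply: nearW => n; exact: Bc.
  by move: muAc; rewrite muA lee_fin -[leLHS]mulr1 ler_pM2l.
by rewrite leNgt => /negP; apply; rewrite -lte_fin -muE muA lte_fin.
Qed.

End MaximizingState.

Lemma exists_maximizing_measure : exists mu : probability SdB R,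
  [/\ T_invariant mu, T_ergodic mu, mu X = 1%E & (\int[mu]_h cube_mass h)%E = dstar f].
Proof.
have C0 : C (0 : Sd -> R) by exact: continuous_cst_fun.
have CD phi psi : C phi -> C psi -> C (phi + psi) by exact: continuousD_fun.
have CZ (c : R) phi : C phi -> C (c *: phi) by exact: continuousZ_fun.
have [L [linL leL Lm extL]] := extreme_hahn_banach C0 CD CZ (upper_mean_sublinear f)
  (@unit_mass_continuous R d).
have [mu muE] := daniell_probability linL (state_ge0 linL leL) (state1 linL leL).
exists mu; split.
- exact: (state_invariant linL leL muE).
- exact: (state_ergodic linL leL extL muE).
- exact: (state_closure linL leL muE).
- rewrite integral_cube_mass dstarE -Lm; congr EFin.
  apply: (Rintegral_daniell linL (state_ge0 linL leL) (state1 linL leL) muE).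
  exact: unit_mass_continuous.
Qed.

End OrbitClosure.

Theorem theorem2p2 (R : realType) (d : nat) (hd : (0 < d)%N) (f : Sd R d) :
  let X : set (SdB R d) := wclosure (range (fun v : d.-tuple R => Tshift v f)) in
  dstar f = ereal_sup [set (\int[mu]_h cube_mass h)%E
                       | mu in [set mu : probability (SdB R d) R |
                                  T_invariant mu /\ mu X = 1%E]]
  /\ exists mu : probability (SdB R d) R,
       [/\ T_invariant mu, T_ergodic mu, mu X = 1%E &
           (\int[mu]_h cube_mass h)%E = dstar f].
Proof.
move=> X; have [mu [imu emu muX muE]] := exists_maximizing_measure f.
split; last by exists mu.
apply/eqP; rewrite eq_le; apply/andP; split.
  by rewrite -muE; apply: ereal_sup_ubound; exists mu.
by apply: ge_ereal_sup => _ [nu [inu nuX] <-]; exact: integral_cube_mass_le.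
Qed.
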